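(* Let $f:\mathbb{R}^n\to\mathbb{R}$ and $x_0\in\mathbb{R}^n$. Suppose that the level set $\mathcal{L}_f(x_0)=\{x : f(x)\le f(x_0)\}$ is compact, and that $f$ is twice uniformly Lipschitz continuously differentiable on an open neighborhood of $\mathcal{L}_f(x_0)$ that includes the trial points generated by the Damped Newton-CG algorithm (described in the context) started at $x_0$, with $L_H$ a Lipschitz constant of $\nabla^2 f$ on this neighborhood. Let $f_{\mathrm{low}}$ and $U_H>0$ be such that $f(x)\ge f_{\mathrm{low}}$ and $\|\nabla^2f(x)\|\le U_H$ for $x\in\mathcal{L}_f(x_0)$. Let $\epsilon_g>0$, $\epsilon_H\in(0,1)$, $\theta,\zeta\in(0,1)$, $\eta>0$ be the parameters of the algorithm, and define $$c_{sol} = \frac{\eta}{6}\min\left\{ \left[ \frac{4}{\sqrt{(4+\zeta)^2+8 L_H}+4+\zeta}\right]^3, \left[ \frac{3\theta^2 (1-\zeta) }{L_H+\eta}\right]^3\right\},\qquad c_{nc} = \frac{\eta}{6}\min\left\{1,\frac{27\theta^3}{(L_H+\eta)^3}\right\},$$ $$\bar{K}_1 := \left\lceil \frac{f(x_0)-f_{\mathrm{low}}}{\min\{c_{sol},c_{nc}\}}\max\left\{\epsilon_g^{-3}\epsilon_H^3,\epsilon_H^{-3}\right\} \right\rceil .$$ Suppose that the values of $M$ used or calculated at each instance of Capped CG satisfy $M\le U_H$. Then the number of Hessian-vector products and/or gradient evaluations required by the Damped Newton-CG algorithm to output an iterate $x_k$ satisfying $\|\nabla f(x_k)\|\le\epsilon_g$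 is at most $$\left(2\min\{n,J(U_H,\epsilon_H,\zeta)\}+2\right)(\bar K_1+1),$$ where $J(\cdot,\cdot,\cdot)$ is defined in the context. For $n$ sufficiently large, this bound is $\tilde{\mathcal O}\left(\max\{\epsilon_g^{-3}\epsilon_H^{5/2},\epsilon_H^{-7/2}\}\right)$, while if $J(U_H,\epsilon_H,\zeta)\ge n$, the bound is $\tilde{\mathcal O}\left(n\max\{\epsilon_g^{-3}\epsilon_H^{3},\epsilon_H^{-3}\}\right)$.
   Context: $\|\cdot\|$ is the Euclidean norm (or induced matrix norm); $\lambda_{\min}$ is the smallest eigenvalue; $\mathrm{sgn}(0)=1$. $\tilde{\mathcal O}$ denotes $\mathcal O$ with logarithmic terms omitted, with the dependence on $\epsilon_g,\epsilon_H$ (and $n$ where displayed) shown. Definition of $J$. For $M\ge0$, $\epsilon,\zeta\in(0,1)$, let $\kappa=\frac{M+2\epsilon}{\epsilon}$, $\hat\zeta=\frac{\zeta}{3\kappa}$, $\tau=\frac{\sqrt\kappa}{\sqrt\kappa+1}$, $T=\frac{4\kappa^4}{(1-\sqrt\tau)^2}$. Then $J(M,\epsilon,\zeta)$ is the smallest integer $J$ such that $\sqrt T\,\tau^{J/2}\le\hat\zeta$. Capped CG. Inputs: symmetric $H\in\mathbb{R}^{n\times n}$, $g\ne 0$, damping $\epsilon\in(0,1)$, accuracy $\zeta\in(0,1)$, optional scalar $M\ge 0$ (set to $0$ if not provided). Let $\bar H=H+2\epsilon I$. At any time, $\kappa=\frac{M+2\epsilon}{\epsilon}$, $\hat\zeta=\frac{\zeta}{3\kappa}$,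 $\tau=\frac{\sqrt\kappa}{\sqrt\kappa+1}$, $T=\frac{4\kappa^4}{(1-\sqrt\tau)^2}$ are computed from the current $M$. ''Update $M$ with $u$'' means: if $\|Hu\|>M\|u\|$, replace $M$ by $\|Hu\|/\|u\|$ and recompute $\kappa,\hat\zeta,\tau,T$. Start with $y_0=0$, $r_0=g$, $p_0=-g$, $j=0$. If $p_0^\top\bar Hp_0<\epsilon\|p_0\|^2$, return $d=p_0$ with d_type=NC; otherwise update $M$ with $p_0$. Then repeat: set $\alpha_j=r_j^\top r_j/p_j^\top\bar Hp_j$, $y_{j+1}=y_j+\alpha_jp_j$, $r_{j+1}=r_j+\alpha_j\bar Hp_j$, $\beta_{j+1}=r_{j+1}^\top r_{j+1}/r_j^\top r_j$, $p_{j+1}=-r_{j+1}+\beta_{j+1}p_j$; increase $j$ by $1$; update $M$ with $p_j$, then with $y_j$, then with $r_j$; then apply the tests in order: (1) if $y_j^\top\bar Hy_j<\epsilon\|y_j\|^2$, return $d=y_j$, d_type=NC; (2) else if $\|r_j\|\le\hat\zeta\|r_0\|$, return $d=y_j$, d_type=SOL; (3) else if $p_j^\top\bar Hp_j<\epsilon\|p_j\|^2$, return $d=p_j$, d_type=NC; (4) else if $\|r_j\|>\sqrt T\tau^{j/2}\|r_0\|$, compute $\alpha_j=r_j^\top r_j/p_j^\top\bar Hp_j$ and $y_{j+1}=y_j+\alpha_jp_j$, find $i\in\{0,\dots,j-1\}$ with $(y_{j+1}-y_i)^\top\bar H(y_{j+1}-y_i)<\epsilon\|y_{j+1}-y_i\|^2$,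 and return $d=y_{j+1}-y_i$, d_type=NC. Cost convention: each iteration uses one matrix-vector product $Hp_j$ (the products of $H$ with $y_j$ and $r_j$ are obtained from these by vector operations), and $Hp_0$ costs one product; the iterates $y_i$ may be either stored, or regenerated by re-running the recurrence when needed in test (4). Minimum Eigenvalue Oracle. Inputs: symmetric $H$, tolerance $\epsilon>0$, optional bound $M$ on $\|H\|$. Output: either $\lambda\le-\epsilon/2$ and a vector $v$ with $\|v\|=1$, $v^\top Hv=\lambda$; or a certificate that $\lambda_{\min}(H)\ge-\epsilon$, which is false with probability $\delta$ for some $\delta\in[0,1)$. Damped Newton-CG. Inputs: $\epsilon_g>0$, $\epsilon_H\in(0,1)$, $\theta\in(0,1)$, $\zeta\in(0,1)$, $\eta>0$, starting point $x_0$, optional upper bound $M>0$ on the Hessian norm. For $k=0,1,2,\dots$: - If $\|\nabla f(x_k)\|>\epsilon_g$: call Capped CG with $H=\nabla^2f(x_k)$, $\epsilon=\epsilon_H$, $g=\nabla f(x_k)$, accuracy $\zeta$ (and $M$ if provided) to get $d$, d_type. If d_type=NC, set $d_k=-\mathrm{sgn}(d^\top g)\frac{|d^\top\nabla^2f(x_k)d|}{\|d\|^2}\frac{d}{\|d\|}$; if d_type=SOL, set $d_k=d$. - Otherwise call the Minimum Eigenvalue Oracle with $H=\nabla^2f(x_k)$, $\epsilon=\epsilon_H$ (and $M$ if provided). If it certifies $\lambda_{\min}(\nabla^2f(x_k))\ge-\epsilon_H$, terminate; else, with $v$ its output and $g=\nabla f(x_k)$, set $d_k=-\mathrm{sgn}(v^\top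 g)\frac{|v^\top\nabla^2f(x_k)v|}{\|v\|^2}v$. - Line search: $\alpha_k=\theta^{j_k}$ with $j_k$ the smallest nonnegative integer such that $f(x_k+\alpha_kd_k)<f(x_k)-\frac{\eta}{6}\alpha_k^3\|d_k\|^3$; set $x_{k+1}=x_k+\alpha_kd_k$. *)

(* Defs.v *)
From HB Require Import structures.
From mathcomp Require Import all_boot all_order all_algebra.
From mathcomp Require Import all_classical all_reals all_analysis.

Set Implicit Arguments.
Unset Strict Implicit.
Unset Printing Implicit Defensive.

Import Order.TTheory GRing.Theory Num.Theory.
Import numFieldNormedType.Exports.

Local Open Scope classical_set_scope.
Local Open Scope ring_scope.

(* Points of R^n are column vectors.  The norm carried by 'cV[R]_n in
   MathComp-Analysis is the sup norm: it is used for the topology and for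
   differentiability only, all estimates are in the Euclidean norm [enorm]. *)

Section Euclidean.
Context {R : realType} {n : nat}.
Implicit Types (u v : 'cV[R]_n) (A : 'M[R]_n).

Definition dotv u v : R := (u^T *m v) 0 0.

Definition enorm u : R := Num.sqrt (dotv u u).

Definition quad A u : R := dotv u (A *m u).

Definition opnorm A : R := sup [set enorm (A *m u) | u in [set u | enorm u <= 1]].

End Euclidean.

Section Calculus.
Context {R : realType} {n : nat}.
Implicit Types (f : 'cV[R]_n -> R) (x y : 'cV[R]_n) (N : set 'cV[R]_n).

Definition grad f x : 'cV[R]_n := \col_i 'D_(delta_mx i 0) f x.

Definition hess f x : 'M[R]_n :=
  \matrix_(i, j) 'D_(delta_mx j 0) (fun y => grad f y i 0) x.

Definition level_set f x0 : set 'cV[R]_n := [set x | f x <= f x0].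

Definition twice_lipschitz_differentiable N f (L_H : R) : Prop :=
  (forall x, N x -> differentiable f x /\ differentiable (grad f) x) /\
  (forall x y, N x -> N y ->
     opnorm (hess f x - hess f y) <= L_H * enorm (x - y)).

End Calculus.

Section CappedCGConstants.
Context {R : realType}.
Implicit Types M eps zeta : R.

Definition cg_kappa M eps : R := (M + 2 * eps) / eps.

Definition cg_zetahat M eps zeta : R := zeta / (3 * cg_kappa M eps).

Definition cg_tau M eps : R :=
  Num.sqrt (cg_kappa M eps) / (Num.sqrt (cg_kappa M eps) + 1).

Definition cg_T M eps : R :=
  4 * cg_kappa M eps ^+ 4 / (1 - Num.sqrt (cg_tau M eps)) ^+ 2.

(* The set below has a least element whenever 0 <= M, 0 < eps and 0 < zeta < 1,
   because then 0 < cg_tau < 1; the default value 0 of [xget] plays no role. *)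
Definition cg_J M eps zeta : int :=
  let ok (j : int) :=
    Num.sqrt (cg_T M eps) * cg_tau M eps `^ (j%:~R / 2) <= cg_zetahat M eps zeta in
  xget 0 [set j : int | ok j /\ forall i : int, ok i -> j <= i].

End CappedCGConstants.

Variant d_type := NC | SOL.

Section CappedCG.
Context {R : realType} {n : nat}.
Variables (H : 'M[R]_n) (g : 'cV[R]_n) (eps zeta M0 : R).

Definition cg_Hbar : 'M[R]_n := H + (2 * eps)%:M.

Definition neg_curv (u : 'cV[R]_n) : bool := quad cg_Hbar u < eps * enorm u ^+ 2.

Definition cg_updM (M : R) (u : 'cV[R]_n) : R :=
  if M * enorm u < enorm (H *m u) then enorm (H *m u) / enorm u else M.

Record cg_state := CGState {
  cg_y : 'cV[R]_n; cg_r : 'cV[R]_n; cg_p : 'cV[R]_n; cg_M : R }.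

Definition cg_init : cg_state := CGState 0 g (- g) (cg_updM M0 (- g)).

Definition cg_alpha (s : cg_state) : R :=
  dotv (cg_r s) (cg_r s) / quad cg_Hbar (cg_p s).

Definition cg_next_y (s : cg_state) : 'cV[R]_n := cg_y s + cg_alpha s *: cg_p s.

Definition cg_next (s : cg_state) : cg_state :=
  let y := cg_next_y s in
  let r := cg_r s + cg_alpha s *: (cg_Hbar *m cg_p s) in
  let beta := dotv r r / dotv (cg_r s) (cg_r s) in
  let p := - r + beta *: cg_p s in
  CGState y r p (cg_updM (cg_updM (cg_updM (cg_M s) p) y) r).

Definition cg_at (j : nat) : cg_state := iter j cg_next cg_init.

Definition cg_test1 (j : nat) : bool := neg_curv (cg_y (cg_at j)).

Definition cg_test2 (j : nat) : bool :=
  enorm (cg_r (cg_at j)) <= cg_zetahat (cg_M (cg_at j)) eps zeta * enorm g.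

Definition cg_test3 (j : nat) : bool := neg_curv (cg_p (cg_at j)).

Definition cg_test4 (j : nat) : bool :=
  Num.sqrt (cg_T (cg_M (cg_at j)) eps) * cg_tau (cg_M (cg_at j)) eps `^ (j%:R / 2)
    * enorm g < enorm (cg_r (cg_at j)).

Definition cg_stops (j : nat) : bool :=
  [|| cg_test1 j, cg_test2 j, cg_test3 j | cg_test4 j].

Definition cg_reaches (j : nat) : Prop :=
  [/\ (0 < j)%N, ~~ neg_curv (- g) &
      forall i : nat, (0 < i < j)%N -> ~~ cg_stops i].

(* [capped_cg d t hv M]: the call returns the vector d with d_type t after hv
   products with H, M being the current value of the bound on return.  As
   updates never decrease the bound, M dominates all the values used or
   calculated during the call.  On exit at iteration j the products are
   H p_0, ..., H p_j; in the last case, if the y_i have not been stored, they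
   are regenerated by re-running the recurrence up to some iteration i < j,
   which costs e <= j further products (e = 0 if they have been stored).
   A call which would go on forever, or find no index i in the last case,
   is related to no output. *)
Variant capped_cg : 'cV[R]_n -> d_type -> nat -> R -> Prop :=
| CG_initial of neg_curv (- g) :
    capped_cg (- g) NC 1 M0
| CG_exit1 j of cg_reaches j & cg_test1 j :
    capped_cg (cg_y (cg_at j)) NC j.+1 (cg_M (cg_at j))
| CG_exit2 j of cg_reaches j & ~~ cg_test1 j & cg_test2 j :
    capped_cg (cg_y (cg_at j)) SOL j.+1 (cg_M (cg_at j))
| CG_exit3 j of cg_reaches j & ~~ cg_test1 j & ~~ cg_test2 j & cg_test3 j :
    capped_cg (cg_p (cg_at j)) NC j.+1 (cg_M (cg_at j))
| CG_exit4 j i e of cg_reaches j & ~~ cg_test1 j & ~~ cg_test2 j &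
    ~~ cg_test3 j & cg_test4 j & (i < j)%N &
    neg_curv (cg_next_y (cg_at j) - cg_y (cg_at i)) & (e <= j)%N :
    capped_cg (cg_next_y (cg_at j) - cg_y (cg_at i)) NC (j.+1 + e)
      (cg_M (cg_at j)).

End CappedCG.

(* [None] is the certificate lambda_min(H) >= - eps.  It is wrong with some
   probability, so nothing can be inferred from it and it is always a possible
   answer. *)
Variant min_eig_oracle {R : realType} {n : nat} (H : 'M[R]_n) (eps : R) :
    option 'cV[R]_n -> Prop :=
| MEO_negative lambda v of lambda <= - (eps / 2) & enorm v = 1 &
    quad H v = lambda : min_eig_oracle H eps (Some v)
| MEO_certificate : min_eig_oracle H eps None.

Section DampedNewtonCG.
Context {R : realType} {n : nat}.
Variables (f : 'cV[R]_n -> R) (eps_g eps_H theta zeta eta : R).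
Variable (Mopt : option R).

Definition sgn1 (a : R) : R := if a < 0 then -1 else 1.

Definition nc_direction (x d : 'cV[R]_n) : 'cV[R]_n :=
  - (sgn1 (dotv d (grad f x)) * (`|quad (hess f x) d| / enorm d ^+ 2)) *:
    ((enorm d)^-1 *: d).

Definition meo_direction (x v : 'cV[R]_n) : 'cV[R]_n :=
  - (sgn1 (dotv v (grad f x)) * (`|quad (hess f x) v| / enorm v ^+ 2)) *: v.

Definition capped_cg_call (x : 'cV[R]_n) :=
  capped_cg (hess f x) (grad f x) eps_H zeta (odflt 0 Mopt).

(* [dncg_direction x o hv]: the search direction computed at x is d if
   o = Some d, with hv Hessian-vector products; o = None if the oracle makes
   the algorithm terminate.  The number of products spent by the oracle is
   left arbitrary. *)
Variant dncg_direction (x : 'cV[R]_n) : option 'cV[R]_n -> nat -> Prop :=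
| Dir_NC d hv M of eps_g < enorm (grad f x) & capped_cg_call x d NC hv M :
    dncg_direction x (Some (nc_direction x d)) hv
| Dir_SOL d hv M of eps_g < enorm (grad f x) & capped_cg_call x d SOL hv M :
    dncg_direction x (Some d) hv
| Dir_MEO v hv of enorm (grad f x) <= eps_g &
    min_eig_oracle (hess f x) eps_H (Some v) :
    dncg_direction x (Some (meo_direction x v)) hv
| Dir_terminate hv of enorm (grad f x) <= eps_g &
    min_eig_oracle (hess f x) eps_H None :
    dncg_direction x None hv.

Definition ls_accept (x d : 'cV[R]_n) (j : nat) : bool :=
  f (x + theta ^+ j *: d) < f x - eta / 6 * (theta ^+ j) ^+ 3 * enorm d ^+ 3.

(* The trial point x + theta^j d is computed iff all the previous ones have
   been rejected. *)
Definition ls_tries (x d : 'cV[R]_n) (j : nat) : Prop :=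
  forall i : nat, (i < j)%N -> ~~ ls_accept x d i.

(* One iteration from x: search direction (if any), number of Hessian-vector
   products, next iterate (if any).  The last two constructors are the
   breakdowns (an endless line search, a Capped CG call without output); they
   end the run, so that no success is built into the notion of run. *)
Variant dncg_iteration (x : 'cV[R]_n) :
    option 'cV[R]_n -> nat -> option 'cV[R]_n -> Prop :=
| Iter_step d hv j of dncg_direction x (Some d) hv & ls_tries x d j &
    ls_accept x d j :
    dncg_iteration x (Some d) hv (Some (x + theta ^+ j *: d))
| Iter_terminate hv of dncg_direction x None hv :
    dncg_iteration x None hv None
| Iter_no_step d hv of dncg_direction x (Some d) hv &
    (forall j, ~~ ls_accept x d j) :
    dncg_iteration x (Some d) hv None
| Iter_no_direction of (forall o hv, ~ dncg_direction x o hv) :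
    dncg_iteration x None 0 None.

Record dncg_trace := DncgTrace {
  iterate : nat -> option 'cV[R]_n;
  direction : nat -> option 'cV[R]_n;
  hv_count : nat -> nat }.

(* A complete run from x0: iterate k is None iff the run has ended before
   producing x_k. *)
Definition dncg_run (x0 : 'cV[R]_n) (t : dncg_trace) : Prop :=
  iterate t 0%N = Some x0 /\
  forall k : nat,
    match iterate t k with
    | Some x => dncg_iteration x (direction t k) (hv_count t k) (iterate t k.+1)
    | None => iterate t k.+1 = None
    end.

Definition trial_point (t : dncg_trace) : set 'cV[R]_n :=
  [set z | exists k x d j, [/\ iterate t k = Some x, direction t k = Some d,
    ls_tries x d j & z = x + theta ^+ j *: d]].

(* Hessian-vector products and gradient evaluations up to the output of x_k:
   gradients at x_0, ..., x_k, products in iterations 0, ..., k - 1. *)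
Definition dncg_cost (t : dncg_trace) (k : nat) : nat :=
  (\sum_(i < k) hv_count t i + k.+1)%N.

End DampedNewtonCG.

Section Bounds.
Context {R : realType}.
Variables (theta zeta eta L_H U_H Delta : R).

Definition c_sol : R := eta / 6 * Num.min
  ((4 / (Num.sqrt ((4 + zeta) ^+ 2 + 8 * L_H) + 4 + zeta)) ^+ 3)
  ((3 * theta ^+ 2 * (1 - zeta) / (L_H + eta)) ^+ 3).

Definition c_nc : R :=
  eta / 6 * Num.min 1 (27 * theta ^+ 3 / (L_H + eta) ^+ 3).

(* Delta stands for f(x_0) - f_low. *)
Definition K1bar (eps_g eps_H : R) : int :=
  Num.ceil (Delta / Num.min c_sol c_nc
            * Num.max (eps_g ^- 3 * eps_H ^+ 3) (eps_H ^- 3)).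

Definition dncg_bound (n : nat) (eps_g eps_H : R) : R :=
  (2 * (Num.min n%:Z (cg_J U_H eps_H zeta))%:~R + 2)
    * ((K1bar eps_g eps_H)%:~R + 1).

End Bounds.

(* h(n, eps_g, eps_H) = O~(q(n, eps_g, eps_H)) on the domain D: big-O, uniformly
   in the three arguments, up to a power of the logarithms of the tolerances. *)
Definition soft_O {R : realType} (D : nat -> R -> R -> Prop)
    (h q : nat -> R -> R -> R) : Prop :=
  exists (C : R) (p : nat), 0 < C /\
    forall n eps_g eps_H, D n eps_g eps_H ->
      `|h n eps_g eps_H|
        <= C * (1 + `|ln eps_g| + `|ln eps_H|) ^+ p * `|q n eps_g eps_H|.

(* Main.v *)
Require Import Defs.
From mathcomp Require Import all_boot all_order all_algebra.
From mathcomp Require Import all_classical all_reals all_analysis.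
From mathcomp Require Import zify ring lra.
Import Order.TTheory GRing.Theory Num.Theory.
Import numFieldNormedType.Exports.
Local Open Scope classical_set_scope.
Local Open Scope ring_scope.

Set Implicit Arguments.
Unset Strict Implicit.
Unset Printing Implicit Defensive.

(** While the gradient exceeds [eps_g], every iteration of the algorithm calls the
    capped conjugate gradient method and decreases [f] by at least
    [c * m ^+ 3], with [c] the smaller of [c_sol] and [c_nc] and
    [m = Num.min (eps_g / eps_H) eps_H], unless the gradient at the new iterate
    is at most [eps_g].  The total decrease is at most [f x0 - f_low], which
    leaves room for [K1bar] iterations ([run_progress]).  One call costs at most
    [2 * Num.min n J + 1] products ([capped_cg_cost]), to which one gradient per
    iterate is added.  The asymptotic statements come from
    [J = O(sqrt kappa * ln kappa)] and [kappa = O(eps_H ^-1)] ([cg_J_le]).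

    A run may also end by a breakdown, so it must be shown that each call
    returns and that each line search ends.

    A call of capped conjugate gradient returns ([capped_cg_returns]).  As long as
    no test succeeds the residuals are nonzero and mutually orthogonal, which
    cannot last beyond iteration [n].  If the residual decreases too slowly, an
    index [i] as in the fourth test exists: otherwise the quadratic would be
    strongly convex between the last iterate and all the former ones, and an
    estimate sequence in the manner of Nesterov would give the accelerated rate
    ([estimate_sequence], [residual_bound]).  The same two tests on the residual
    show that the number of iterations is at most [J], which is monotone in the
    bound on the Hessian ([cg_reaches_le_J]).

    The line search rests on the cubic Taylor bound.  The neighbourhood on which
    the Hessian is Lipschitz need not be convex, and a trial point may be reached
    only through points where [f] is uncontrolled.  However, as long as the cubic
    model predicts no increase, the segment stays in the level set and cannot
    leave the neighbourhood ([segment_in]).  For a direction of negative curvature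
    this makes every step shorter than [3 / (L_H + eta)] acceptable
    ([nc_accept]).  For a Newton step [d] it makes a step [a] in (0, 1]
    acceptable when [(L_H + eta) * a ^+ 2 * enorm d < 3 * eps_H]
    ([sol_accept]); if this fails for [a = 1] then [d] is long, which already
    accounts for the second term of [c_sol], and if it holds the unit step is
    taken inside the neighbourhood, where the new gradient is bounded by a
    quadratic in [enorm d], which gives the first term ([sol_decrease]).

    Conjugate gradient requires a symmetric matrix, and the Hessian is the matrix
    of iterated partial derivatives: its symmetry is proved from second
    differences ([hess_sym]). *)

(** * Euclidean geometry *)

Section EuclideanTheory.
Context {R : realType} {n : nat}.
Implicit Types (u v w : 'cV[R]_n) (A : 'M[R]_n).

Lemma dotvE u v : dotv u v = \sum_i u i 0 * v i 0.
Proof. by rewrite /dotv mxE; apply: eq_bigr => i _; rewrite mxE. Qed.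

Lemma dotvC u v : dotv u v = dotv v u.
Proof. by rewrite !dotvE; apply: eq_bigr => i _; rewrite mulrC. Qed.

Lemma dotvDl u v w : dotv (u + v) w = dotv u w + dotv v w.
Proof. by rewrite /dotv linearD /= mulmxDl mxE. Qed.

Lemma dotvDr u v w : dotv u (v + w) = dotv u v + dotv u w.
Proof. by rewrite /dotv mulmxDr mxE. Qed.

Lemma dotvZl a u v : dotv (a *: u) v = a * dotv u v.
Proof. by rewrite /dotv linearZ /= -scalemxAl mxE. Qed.

Lemma dotvZr a u v : dotv u (a *: v) = a * dotv u v.
Proof. by rewrite /dotv -scalemxAr mxE. Qed.

Lemma dotvNl u v : dotv (- u) v = - dotv u v.
Proof. by rewrite -scaleN1r dotvZl mulN1r. Qed.

Lemma dotvNr u v : dotv u (- v) = - dotv u v.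
Proof. by rewrite -scaleN1r dotvZr mulN1r. Qed.

Lemma dotvBl u v w : dotv (u - v) w = dotv u w - dotv v w.
Proof. by rewrite dotvDl dotvNl. Qed.

Lemma dotvBr u v w : dotv u (v - w) = dotv u v - dotv u w.
Proof. by rewrite dotvDr dotvNr. Qed.

Lemma dotv0l u : dotv 0 u = 0.
Proof. by rewrite /dotv trmx0 mul0mx mxE. Qed.

Lemma dotv0r u : dotv u 0 = 0.
Proof. by rewrite dotvC dotv0l. Qed.

Lemma dotvv_ge0 u : 0 <= dotv u u.
Proof. by rewrite dotvE; apply: sumr_ge0 => i _; rewrite -expr2 sqr_ge0. Qed.

Lemma dotvv_eq0 u : (dotv u u == 0) = (u == 0).
Proof.
apply/idP/eqP => [|->]; last by rewrite dotv0l.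
rewrite dotvE psumr_eq0 => [/allP u0|i _]; last by rewrite -expr2 sqr_ge0.
apply/matrixP => i j; rewrite ord1 mxE.
by move: (u0 i); rewrite mem_index_enum -expr2 sqrf_eq0 => /(_ isT)/eqP.
Qed.

Lemma enorm_ge0 u : 0 <= enorm u.
Proof. exact: sqrtr_ge0. Qed.

Lemma enorm_sqr u : enorm u ^+ 2 = dotv u u.
Proof. by rewrite sqr_sqrtr ?dotvv_ge0. Qed.

Lemma enorm_eq0 u : (enorm u == 0) = (u == 0).
Proof. by rewrite -dotvv_eq0 -enorm_sqr sqrf_eq0. Qed.

Lemma enorm0 : enorm (0 : 'cV[R]_n) = 0.
Proof. by apply/eqP; rewrite enorm_eq0. Qed.

Lemma enorm_gt0 u : (0 < enorm u) = (u != 0).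
Proof. by rewrite lt_def enorm_eq0 enorm_ge0 andbT. Qed.

Lemma enormZ a u : enorm (a *: u) = `|a| * enorm u.
Proof.
by rewrite /enorm dotvZl dotvZr mulrA -expr2 sqrtrM ?sqr_ge0 // sqrtr_sqr.
Qed.

Lemma enormN u : enorm (- u) = enorm u.
Proof. by rewrite -scaleN1r enormZ normrN1 mul1r. Qed.

(** Cauchy-Schwarz, from the nonnegativity of the square of the combination
    that vanishes in the case of equality. *)
Lemma dotv_le u v : dotv u v <= enorm u * enorm v.
Proof.
have [->|v0] := eqVneq v 0; first by rewrite dotv0r enorm0 mulr0.
have [->|u0] := eqVneq u 0; first by rewrite dotv0l enorm0 mul0r.
have vp : 0 < enorm v by rewrite enorm_gt0.
have up : 0 < enorm u by rewrite enorm_gt0.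
have := dotvv_ge0 (enorm v *: u - enorm u *: v).
rewrite dotvBl !dotvBr !dotvZl !dotvZr -!enorm_sqr (dotvC v u) => h.
rewrite -(ler_pM2l (mulr_gt0 up vp)); nra.
Qed.

Lemma enormD u v : enorm (u + v) <= enorm u + enorm v.
Proof.
rewrite -ler_sqr ?nnegrE ?addr_ge0 ?enorm_ge0 //.
rewrite enorm_sqr dotvDl !dotvDr (dotvC v u) sqrrD -!enorm_sqr.
by have := dotv_le u v; lra.
Qed.

Lemma quadZ A a u : quad A (a *: u) = a ^+ 2 * quad A u.
Proof. by rewrite /quad -scalemxAr dotvZl dotvZr mulrA -expr2. Qed.

Lemma quadN A u : quad A (- u) = quad A u.
Proof. by rewrite -scaleN1r quadZ sqrrN expr1n mul1r. Qed.

Lemma norm_entry_le u i : `|u i 0| <= enorm u.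
Proof.
rewrite -sqrtr_sqr ler_sqrt ?dotvv_ge0 // dotvE (bigD1 i) //= -expr2 lerDl.
by apply: sumr_ge0 => j _; rewrite -expr2 sqr_ge0.
Qed.

Lemma enorm_delta i : enorm (delta_mx i 0 : 'cV[R]_n) = 1.
Proof.
rewrite /enorm dotvE (bigD1 i) //= big1 ?mxE ?eqxx ?mulr1 ?addr0 ?sqrtr1 //.
by move=> j /negbTE ji; rewrite mxE ji mul0r.
Qed.

Lemma enorm_le_sum u : enorm u <= \sum_i `|u i 0|.
Proof.
have e : u = \sum_i u i 0 *: delta_mx i 0.
  by rewrite {1}[u]matrix_sum_delta; apply: eq_bigr => i _; rewrite big_ord1.
rewrite {1}e; elim/big_ind2: _ => [|a b c d ab cd|i _]; first by rewrite enorm0.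
  by apply: (le_trans (enormD _ _)); rewrite lerD.
by rewrite enormZ enorm_delta mulr1.
Qed.

(** [opnorm] is a supremum, hence a bound only because it is taken over a
    bounded set. *)
Lemma opnorm_has_ubound A :
  has_ubound [set enorm (A *m u) | u in [set u | enorm u <= 1]].
Proof.
exists (\sum_i \sum_j `|A i j|) => _ [u /= u1 <-].
apply: (le_trans (enorm_le_sum _)); apply: ler_sum => i _.
rewrite mxE; apply: (le_trans (ler_norm_sum _ _ _)); apply: ler_sum => j _.
rewrite normrM ler_piMr //; exact: le_trans (norm_entry_le _ _) u1.
Qed.

Lemma enorm_mulmx_le A u : enorm (A *m u) <= opnorm A * enorm u.
Proof.
have [->|u0] := eqVneq u 0; first by rewrite mulmx0 enorm0 mulr0.
have up : 0 < enorm u by rewrite enorm_gt0.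
rewrite -ler_pdivrMr //.
apply: sup_upper_bound; first split.
- by exists (enorm (A *m 0)), 0 => //=; rewrite enorm0.
- exact: opnorm_has_ubound.
exists ((enorm u)^-1 *: u) => /=.
  by rewrite enormZ ger0_norm ?invr_ge0 ?enorm_ge0 // mulVf // gt_eqF.
by rewrite -scalemxAr enormZ ger0_norm ?invr_ge0 ?enorm_ge0 // mulrC.
Qed.

Lemma dotv_mulmx_le A u v : dotv u (A *m v) <= opnorm A * enorm u * enorm v.
Proof.
apply: (le_trans (dotv_le _ _)); rewrite (mulrC (opnorm A)) -mulrA.
by rewrite ler_wpM2l ?enorm_ge0 ?enorm_mulmx_le.
Qed.

Lemma dotv_mulmxC A u v : A^T = A -> dotv u (A *m v) = dotv (A *m u) v.
Proof. by move=> sA; rewrite /dotv trmx_mul sA mulmxA. Qed.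

End EuclideanTheory.

(** * Differential calculus along lines *)

Lemma increment_le {R : realType} (F F' G G' : R -> R) (a : R) :
  0 <= a ->
  (forall s : R, 0 <= s <= a -> is_derive s 1 F (F' s)) ->
  (forall s : R, 0 <= s <= a -> is_derive s 1 G (G' s)) ->
  (forall s : R, 0 <= s <= a -> F' s <= G' s) ->
  F a - F 0 <= G a - G 0.
Proof.
move=> a0 dF dG le.
have dFG s : 0 <= s <= a -> is_derive s 1 (F - G) (F' s - G' s).
  by move=> sa; apply: is_deriveB; [exact: dF|exact: dG].
have [||c ca] := @MVT_segment R (F - G) (fun s => F' s - G' s) 0 a a0.
- by move=> s sa; apply: dFG; rewrite !ltW ?(itvP sa).
- apply: derivable_within_continuous => s sa.
  by apply: (@ex_derive _ _ _ _ _ _ _ (dFG s _)); rewrite !(itvP sa).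
have /le h : 0 <= c <= a by rewrite !(itvP ca).
rewrite subr0 => e.
have : (F - G) a - (F - G) 0 <= 0.
  by rewrite e mulr_le0_ge0 // subr_le0.
rewrite -![(F - G) _]/(F _ - G _); lra.
Qed.

(** Every Taylor bound below compares a function with such a cubic. *)
Lemma is_derive_cubic {R : realType} (c1 c2 c3 s : R) :
  is_derive s 1 (fun s => c1 * s + c2 * s ^+ 2 + c3 * s ^+ 3)
    (c1 + 2 * c2 * s + 3 * c3 * s ^+ 2).
Proof.
have -> : (fun s : R => c1 * s + c2 * s ^+ 2 + c3 * s ^+ 3) =
    c1 \*: id + c2 \*: (id ^+ 2) + c3 \*: (id ^+ 3).
  by apply/funext => r.
apply: is_derive_eq.
rewrite /= -![_ *: _]/(_ * _) /=; ring.
Qed.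

Lemma is_derive_scaleB {R : realType} (c a d1 d2 : R) (F1 F2 : R -> R) :
  is_derive a 1 F1 d1 -> is_derive a 1 F2 d2 ->
  is_derive a 1 (fun a => c * (F1 a - F2 a)) (c * (d1 - d2)).
Proof.
move=> h1 h2; have -> : (fun a => c * (F1 a - F2 a)) = c \*: (F1 - F2) by [].
exact: is_deriveZ.
Qed.

Section Line.
Context {R : realType} {n : nat}.
Implicit Types (F : 'cV[R]_n -> R) (x y d : 'cV[R]_n).

Lemma is_derive_line F x d (s : R) : differentiable F (x + s *: d) ->
  is_derive s 1 (fun s => F (x + s *: d))
    (\sum_i 'D_(delta_mx i 0) F (x + s *: d) * d i 0).
Proof.
set y := x + s *: d => dF.
have E : (fun h : R => h^-1 *: (((fun s => F (x + s *: d)) \o shift s) (h *: 1)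
      - F (x + s *: d))) =
    (fun h : R => h^-1 *: ((F \o shift y) (h *: d) - F y)).
  apply/funext => h /=; congr (_ *: (F _ - _)).
  by rewrite /y [h *: 1]mulr1 scalerDl addrCA.
have D : 'D_d F y = \sum_i 'D_(delta_mx i 0) F y * d i 0.
  rewrite deriveE //.
  have -> : d = \sum_i d i 0 *: delta_mx i 0.
    by rewrite {1}[d]matrix_sum_delta; apply: eq_bigr => i _; rewrite big_ord1.
  rewrite linear_sum; apply: eq_bigr => i _.
  rewrite linearZ /= deriveE // mulrC summxE (bigD1 i) //= big1 => [|j ji].
    by rewrite !mxE !eqxx addr0 mulr1.
  by rewrite !mxE eq_sym (negbTE ji) mulr0.
apply: DeriveDef; rewrite /derivable /derive E //.
exact: diff_derivable.
Qed.

End Line.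

Lemma dotv_mulmxZ_le {R : realType} {n : nat} (A B : 'M[R]_n)
    (u v : 'cV[R]_n) (a c : R) :
  dotv (a *: u) (A *m v) <= dotv (a *: u) (B *m v) + c ->
  a * dotv u (A *m v) <= a * dotv u (B *m v) + c.
Proof. by rewrite !dotvZl. Qed.

Section Smooth.
Context {R : realType} {n : nat}.
Variables (f : 'cV[R]_n -> R) (N : set 'cV[R]_n) (L_H : R).
Hypotheses (hf : twice_lipschitz_differentiable N f L_H).
Implicit Types (x d u w : 'cV[R]_n) (a s : R).

Let seg_in x d a := forall s : R, 0 <= s <= a -> N (x + s *: d).

Lemma is_derive_f_line x d s : N (x + s *: d) ->
  is_derive s 1 (fun s => f (x + s *: d)) (dotv d (grad f (x + s *: d))).
Proof.
move=> /hf.1 [df _]; have := is_derive_line df => ?; apply: is_derive_eq.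
by rewrite dotvE; apply: eq_bigr => i _; rewrite mxE mulrC.
Qed.

Lemma is_derive_gradi_line x d s i : N (x + s *: d) ->
  is_derive s 1 (fun s => grad f (x + s *: d) i 0)
    ((hess f (x + s *: d) *m d) i 0).
Proof.
move=> /hf.1 [_ df].
have dfi : differentiable (fun y => grad f y i 0) (x + s *: d).
  exact: (@differentiable_comp _ _ _ _ (grad f)
           (fun M : 'cV[R]_n => M i 0) _ df (differentiable_coord _ _ _)).
have := is_derive_line dfi => ?; apply: is_derive_eq.
by rewrite mxE; apply: eq_bigr => j _; rewrite mxE.
Qed.

Lemma is_derive_grad_line x d w s : N (x + s *: d) ->
  is_derive s 1 (fun s => dotv w (grad f (x + s *: d)))
    (dotv w (hess f (x + s *: d) *m d)).
Proof.
move=> Nx; rewrite dotvE.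
have -> : (fun s => dotv w (grad f (x + s *: d))) =
    \sum_i (w i 0 \*: (fun s => grad f (x + s *: d) i 0)).
  by apply/funext => r; rewrite dotvE fct_sumE.
apply: is_derive_sum => i; apply: is_deriveZ; exact: is_derive_gradi_line.
Qed.

Lemma hess_lipschitz_line x d u w s : 0 <= s -> N x -> N (x + s *: d) ->
  dotv w (hess f (x + s *: d) *m u) <=
  dotv w (hess f x *m u) + L_H * enorm d * enorm w * enorm u * s.
Proof.
move=> s0 Nx Ny; rewrite -lerBlDl -dotvBr -mulmxBl.
apply: (le_trans (dotv_mulmx_le _ _ _)).
have e : x + s *: d - x = s *: d by rewrite addrC addKr.
have := hf.2 _ _ Ny Nx; rewrite e enormZ (ger0_norm s0) => h.
have wu : 0 <= enorm w * enorm u by rewrite mulr_ge0 ?enorm_ge0.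
rewrite -mulrA; apply: le_trans (ler_wpM2r wu h) _.
by rewrite le_eqVlt; apply/orP; left; apply/eqP; ring.
Qed.

(** The gradient is tested against a fixed vector [w], which makes it a function
    of one real variable to which [increment_le] applies. *)
Lemma grad_taylor_le x d w a : 0 <= a -> seg_in x d a ->
  dotv w (grad f (x + a *: d)) <=
  dotv w (grad f x) + a * dotv w (hess f x *m d)
    + L_H / 2 * enorm d ^+ 2 * enorm w * a ^+ 2.
Proof.
move=> a0 seg; have Nx : N x by rewrite -[x]addr0 -(scale0r d); apply: seg; lra.
set c2 := L_H / 2 * _ * _.
have := @increment_le R (fun s => dotv w (grad f (x + s *: d))) _ _ _ a a0
  (fun s sa => is_derive_grad_line w (seg s sa))
  (fun s _ => is_derive_cubic (dotv w (hess f x *m d)) c2 0 s).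
rewrite scale0r addr0 => h.
suff : dotv w (grad f (x + a *: d)) - dotv w (grad f x) <=
    dotv w (hess f x *m d) * a + c2 * a ^+ 2 + 0 * a ^+ 3
    - (dotv w (hess f x *m d) * 0 + c2 * 0 ^+ 2 + 0 * 0 ^+ 3) by lra.
apply: h => s sa; have /andP[s0 _] := sa.
apply: (le_trans (hess_lipschitz_line _ _ s0 Nx (seg s sa))).
by rewrite /c2 le_eqVlt; apply/orP; left; apply/eqP; field.
Qed.

Lemma f_taylor_le x d a : 0 <= a -> seg_in x d a ->
  f (x + a *: d) <= f x + a * dotv d (grad f x)
    + a ^+ 2 / 2 * quad (hess f x) d + L_H / 6 * a ^+ 3 * enorm d ^+ 3.
Proof.
move=> a0 seg.
have := @increment_le R (fun s => f (x + s *: d)) _ _ _ a a0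
  (fun s sa => is_derive_f_line (seg s sa))
  (fun s _ => is_derive_cubic (dotv d (grad f x)) (quad (hess f x) d / 2)
     (L_H / 6 * enorm d ^+ 3) s).
rewrite scale0r addr0 !mulr0 !expr0n /= !mulr0 !addr0 subr0 => h.
rewrite -!addrA -lerBlDl; apply: le_trans (h _) _; last first.
  by rewrite le_eqVlt; apply/orP; left; apply/eqP; field.
move=> s /andP[s0 sa].
have segs : seg_in x d s.
  by move=> r /andP[r0 rs]; apply: seg; rewrite r0 (le_trans rs).
apply: (le_trans (grad_taylor_le _ s0 segs)).
by rewrite /quad le_eqVlt; apply/orP; left; apply/eqP; field.
Qed.

(** Tested against the difference vector itself, the one-directional bound on
    the gradient becomes a bound in norm. *)
Lemma grad_error_le x d : 0 <= L_H -> seg_in x d 1 ->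
  enorm (grad f (x + d) - (grad f x + hess f x *m d))
    <= L_H / 2 * enorm d ^+ 2.
Proof.
move=> L0 seg; set w := grad f (x + d) - _.
have [->|w0] := eqVneq w 0.
  by rewrite enorm0 mulr_ge0 ?sqr_ge0 ?divr_ge0.
have := @grad_taylor_le x d w 1 ler01 seg.
rewrite scale1r mul1r expr1n mulr1 => h.
have wp : 0 < enorm w by rewrite enorm_gt0.
have e : enorm w ^+ 2 = dotv w (grad f (x + d))
    - (dotv w (grad f x) + dotv w (hess f x *m d)).
  by rewrite enorm_sqr -dotvDr -dotvBr.
rewrite -(ler_pM2r wp) -expr2 e; lra.
Qed.

(** The increment of [a |-> f (x + s v + a u) - f (x + a u)] is an increment of
    the gradient tested against [u], of first order in [s].  The sign [sg] yields
    both the upper and the lower estimate. *)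
Lemma mixed_difference_le x u v (sg s : R) : enorm u = 1 -> enorm v = 1 ->
  `|sg| = 1 -> 0 <= s -> 0 <= L_H ->
  (forall a b : R, 0 <= a <= s -> 0 <= b <= s -> N (x + a *: u + b *: v)) ->
  sg * (f (x + s *: u + s *: v) - f (x + s *: u) - f (x + s *: v) + f x) <=
  sg * (s ^+ 2 * dotv u (hess f x *m v)) + 3 / 2 * L_H * s ^+ 3.
Proof.
move=> u1 v1 sg1 s0 L0 sq.
have ss : 0 <= s <= s by rewrite s0 lexx.
have z0 : 0 <= (0 : R) <= s by rewrite lexx.
have Nu (a : R) : 0 <= a <= s -> N (x + a *: u).
  by move=> /sq/(_ z0); rewrite scale0r addr0.
have Nuv (a : R) : 0 <= a <= s -> N (x + s *: v + a *: u).
  by move=> /sq/(_ ss); rewrite addrAC.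
have Nx : N x by have := Nu _ z0; rewrite scale0r addr0.
have su : enorm (sg *: u) = 1 by rewrite enormZ sg1 u1 mulr1.
set c := s * (sg * dotv u (hess f x *m v)) + 3 / 2 * L_H * s ^+ 2.
pose F1 (a : R) := f (x + s *: v + a *: u); pose F2 (a : R) := f (x + a *: u).
have dF (a : R) : 0 <= a <= s -> is_derive a 1 (fun a => sg * (F1 a - F2 a))
    (sg * (dotv u (grad f (x + s *: v + a *: u)) -
           dotv u (grad f (x + a *: u)))).
  by move=> sa; apply: is_derive_scaleB; apply: is_derive_f_line; [apply: Nuv|apply: Nu].
have := increment_le s0 dF (fun a _ => is_derive_cubic c 0 0 a).
rewrite /F1 /F2 !(scale0r, addr0) (addrAC x) => h.
suff : sg * (f (x + s *: u + s *: v) - f (x + s *: u)) - sg * (f (x + s *: v)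
    - f x) <= c * s + 0 * s ^+ 2 + 0 * s ^+ 3
    - (c * 0 + 0 * 0 ^+ 2 + 0 * 0 ^+ 3) by rewrite /c; nra.
apply: h => a sa; have /andP[a0 as_] := sa.
have seg (b : R) : 0 <= b <= s -> N (x + a *: u + b *: v) by exact: sq.
have h2 := grad_taylor_le (sg *: u) s0 seg.
have h1 := hess_lipschitz_line v (sg *: u) a0 Nx (Nu _ sa).
rewrite su v1 3!dotvZl in h2.
rewrite su u1 v1 !mulr1 in h1.
have {}h1 := dotv_mulmxZ_le h1.
have h3 := ler_wpM2l s0 h1.
have e : x + s *: v + a *: u = x + a *: u + s *: v by rewrite addrAC.
rewrite e /c.
have h4 : s * (L_H * a) <= L_H * s ^+ 2.
  by rewrite mulrCA expr2 ler_wpM2l // ler_wpM2l.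
move: h2 h3 h4; clear h1.
generalize (dotv u (hess f (x + a *: u) *m v)) => A.
generalize (dotv u (hess f x *m v)) => B.
generalize (dotv u (grad f (x + a *: u + s *: v))) => C.
generalize (dotv u (grad f (x + a *: u))) => D h2 h3 h4.
lra.
Qed.

End Smooth.

Lemma open_enorm_ball {R : realType} {n : nat} (N : set 'cV[R]_n) x :
  open N -> N x -> exists2 r : R, 0 < r & forall y, enorm (y - x) < r -> N y.
Proof.
move=> oN Nx; have /nbhs_ballP[r /= r0 sub] := open_nbhs_nbhs (conj oN Nx).
exists r => // y yx; apply: sub; split=> // i j; rewrite ord1 /ball /=.
apply: le_lt_trans yx; rewrite distrC.
by have := norm_entry_le (y - x) i; rewrite !mxE.
Qed.

(** The second mixed difference of [f] along two coordinate directions is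
    symmetric in them, while dividing it by [s ^+ 2] approximates either mixed
    partial derivative up to a multiple of [s]. *)
Lemma hess_sym {R : realType} {n : nat} (f : 'cV[R]_n -> R) N L_H x :
  twice_lipschitz_differentiable N f L_H -> 0 <= L_H -> open N -> N x ->
  (hess f x)^T = hess f x.
Proof.
move=> hf L0 oN Nx.
have [r r0 ball] := open_enorm_ball oN Nx.
have dE (A : 'M[R]_n) i j :
    dotv (delta_mx i 0) (A *m (delta_mx j 0 : 'cV[R]_n)) = A i j.
  rewrite dotvE (bigD1 i) //= big1 ?addr0 => [|k /negbTE ki]; last first.
    by rewrite mxE ki mul0r.
  rewrite !mxE !eqxx mul1r (bigD1 j) //= big1 ?addr0 => [|k /negbTE kj].
    by rewrite mxE !eqxx mulr1.
  by rewrite mxE kj mulr0.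
have small i j (s : R) : 0 < s < r / 2 ->
    hess f x i j - hess f x j i <= 3 * L_H * s.
  move=> /andP[s0 sr].
  have sq (k l : 'I_n) (a b : R) : 0 <= a <= s -> 0 <= b <= s ->
      N (x + a *: (delta_mx k 0) + b *: (delta_mx l 0)).
    move=> /andP[a0 as_] /andP[b0 bs]; apply: ball.
    rewrite -(addrA x) [x + _]addrC addrK; apply: (le_lt_trans (enormD _ _)).
    rewrite !enormZ !enorm_delta !ger0_norm //; lra.
  have d1 (k : 'I_n) := @enorm_delta R n k.
  have := @mixed_difference_le R n f N L_H hf x _ _ (-1) s (d1 i) (d1 j)
    (normrN1 _) (ltW s0) L0 (sq i j).
  have := @mixed_difference_le R n f N L_H hf x _ _ 1 s (d1 j) (d1 i)
    (normr1 _) (ltW s0) L0 (sq j i).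
  rewrite !dE (addrAC x) => h1 h2.
  rewrite -(ler_pM2l (exprn_gt0 2 s0)); lra.
have le i j : hess f x i j <= hess f x j i.
  rewrite leNgt; apply/negP; rewrite -subr_gt0.
  set e := _ - _ => e0.
  pose s := Num.min (r / 4) (e / (6 * L_H + 6)).
  have L6 : 0 < 6 * L_H + 6 by lra.
  have s0 : 0 < s by rewrite lt_min !divr_gt0.
  have sr : s <= r / 4 by rewrite ge_min lexx.
  have se : s <= e / (6 * L_H + 6) by rewrite ge_min lexx orbT.
  have /small : 0 < s < r / 2 by rewrite s0 /=; lra.
  move=> /(_ i j); rewrite -/e.
  move: se; rewrite ler_pdivlMr // => se; nra.
by apply/matrixP => i j; rewrite mxE; apply/eqP; rewrite eq_le !le.
Qed.

(** The neighbourhood need not contain the segment from the current iterate to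
    a trial point.  It does as long as a model that bounds [f] from above where
    the Taylor expansion is licit predicts no increase: the first point out of
    the neighbourhood would be a limit of points of the level set. *)
Lemma segment_in {R : realType} {n : nat} (f : 'cV[R]_n -> R) N L_H x0 x d
    (a : R) :
  twice_lipschitz_differentiable N f L_H -> open N ->
  closed (level_set f x0) -> level_set f x0 `<=` N -> level_set f x0 x ->
  (forall s : R, 0 <= s <= a -> s * dotv d (grad f x)
    + s ^+ 2 / 2 * quad (hess f x) d + L_H / 6 * s ^+ 3 * enorm d ^+ 3 <= 0) ->
  forall s : R, 0 <= s <= a -> N (x + s *: d).
Proof.
move=> hf oN cl sub lx model s sa; apply: contrapT => nN.
pose C := [set s : R | 0 <= s <= a /\ ~ N (x + s *: d)].
have infC : has_inf C.
  by split; [exists s|exists 0 => r [/andP[]]].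
pose s1 := inf C.
have s1s : s1 <= s by apply: ge_inf; [exact: infC.2|].
have s10 : 0 <= s1 by apply: lb_le_inf; [exact: infC.1|move=> r [/andP[]]].
have s1a : s1 <= a by case/andP: sa => _; exact: le_trans.
have below (r : R) : 0 <= r -> r < s1 -> N (x + r *: d).
  move=> r0 rs1; apply: contrapT => nr.
  have : s1 <= r.
    apply: ge_inf; [exact: infC.2|split=> //].
    by rewrite r0 (le_trans (ltW rs1)).
  by rewrite leNgt rs1.
have inlevel (r : R) : 0 <= r -> r < s1 -> level_set f x0 (x + r *: d).
  move=> r0 rs1; rewrite /level_set /=; apply: le_trans lx.
  have seg (q : R) : 0 <= q <= r -> N (x + q *: d).
    by move=> /andP[q0 qr]; apply: below; rewrite // (le_lt_trans qr).
  apply: (le_trans (f_taylor_le hf r0 seg)).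
  have : 0 <= r <= a by rewrite r0 (le_trans (ltW rs1)).
  move=> /model; lra.
have cline : continuous (fun r : R => x + r *: d).
  by move=> r; apply: cvgD; [exact: cvg_cst|exact: scalel_continuous].
have Ns1 : N (x + s1 *: d).
  have [s1z|s1p] := eqVneq s1 0.
    by rewrite s1z scale0r addr0; exact: sub.
  have {}s1p : 0 < s1 by rewrite lt_def s1p.
  apply: sub; apply: cl => V /cline /nbhs_ballP[e /= e0 bV].
  pose r := Num.max 0 (s1 - e / 2).
  have r0 : 0 <= r by rewrite le_max lexx.
  have rs : r < s1 by rewrite gt_max s1p /=; lra.
  exists (x + r *: d); split; first exact: inlevel.
  apply: bV; rewrite /ball /= ger0_norm; last by lra.
  have : s1 - e / 2 <= r by rewrite le_max lexx orbT.
  by lra.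
have /cline /nbhs_ballP[e /= e0 bN] := open_nbhs_nbhs (conj oN Ns1).
have [q Cq qs] := inf_adherent e0 infC; case: (Cq) => _; apply.
have s1q : s1 <= q by apply: ge_inf; [exact: infC.2|].
apply: bN; rewrite /ball /= distrC ger0_norm; last by lra.
by rewrite -/s1 in qs; lra.
Qed.

(** * Constants of the capped conjugate gradient method *)

Section Constants.
Context {R : realType}.
Variables (eps zeta : R).
Hypotheses (eps0 : 0 < eps) (zeta01 : 0 < zeta < 1).

Lemma cg_kappa_ge2 M : 0 <= M -> 2 <= cg_kappa M eps.
Proof. by move=> M0; rewrite /cg_kappa ler_pdivlMr // lerDr. Qed.

Lemma cg_kappa_le M M' : M <= M' -> cg_kappa M eps <= cg_kappa M' eps.
Proof. by move=> h; rewrite /cg_kappa ler_pM2r ?invr_gt0 // lerD2r. Qed.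

Lemma cg_tauE M : cg_tau M eps = 1 - (Num.sqrt (cg_kappa M eps) + 1)^-1.
Proof.
have k0 : Num.sqrt (cg_kappa M eps) + 1 != 0.
  by rewrite gt_eqF // ltr_wpDl ?sqrtr_ge0.
by rewrite /cg_tau; field.
Qed.

Lemma cg_tau_gt0 M : 0 <= M -> 0 < cg_tau M eps.
Proof.
move=> /cg_kappa_ge2 k2; apply: divr_gt0; first by rewrite sqrtr_gt0; lra.
by rewrite ltr_wpDl ?sqrtr_ge0.
Qed.

Lemma cg_tau_lt1 M : cg_tau M eps < 1.
Proof. by rewrite cg_tauE ltrBlDr ltrDl invr_gt0 ltr_wpDl ?sqrtr_ge0. Qed.

Lemma cg_tau_le M M' : 0 <= M -> M <= M' -> cg_tau M eps <= cg_tau M' eps.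
Proof.
move=> M0 h; rewrite !cg_tauE lerD2l lerN2 lef_pV2 ?posrE ?ltr_wpDl ?sqrtr_ge0 //.
rewrite lerD2r ler_sqrt ?cg_kappa_le //.
by have := cg_kappa_ge2 (le_trans M0 h); lra.
Qed.

Lemma sqrt_tau_lt1 M : Num.sqrt (cg_tau M eps) < 1.
Proof. by rewrite -[ltRHS]sqrtr1 ltr_sqrt ?cg_tau_lt1. Qed.

Lemma cg_T_ge0 M : 0 <= cg_T M eps.
Proof.
by rewrite /cg_T divr_ge0 ?sqr_ge0 // mulr_ge0 // -[4%N]/(2 * 2)%N exprM sqr_ge0.
Qed.

(** The factor on the left is the one that the convergence estimate
    [residual_bound] produces. *)
Lemma cg_T_ge M : 0 <= M -> 2 * cg_kappa M eps <= cg_T M eps.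
Proof.
move=> M0; have k2 := cg_kappa_ge2 M0; set k := cg_kappa _ _ in k2 *.
have t1 := sqrt_tau_lt1 M; have t0 := sqrtr_ge0 (cg_tau M eps).
rewrite /cg_T ler_pdivlMr; last by rewrite exprn_gt0 // subr_gt0.
have h : (1 - Num.sqrt (cg_tau M eps)) ^+ 2 <= 1 by rewrite expr_le1 //; lra.
apply: (@le_trans _ _ (2 * k * 1)); first by rewrite ler_wpM2l //; lra.
have k3 : 1 <= k ^+ 3 by apply: exprn_ege1; lra.
rewrite -/k mulr1 exprS; nra.
Qed.

Lemma cg_T_le M M' : 0 <= M -> M <= M' -> cg_T M eps <= cg_T M' eps.
Proof.
move=> M0 h; have k2 := cg_kappa_ge2 M0; have kk := cg_kappa_le h.
rewrite /cg_T; apply: ler_pM.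
- by rewrite mulr_ge0 // exprn_ge0 //; lra.
- by rewrite invr_ge0 sqr_ge0.
- by rewrite ler_wpM2l // lerXn2r // nnegrE; lra.
rewrite lef_pV2 ?posrE ?exprn_gt0 ?subr_gt0 ?sqrt_tau_lt1 //.
rewrite ler_sqr ?nnegrE ?subr_ge0 ?(ltW (sqrt_tau_lt1 _)) //.
rewrite lerD2l lerN2.
by rewrite ler_sqrt ?cg_tau_le // ltW // cg_tau_gt0 // (le_trans M0).
Qed.

Lemma cg_zetahat_gt0 M : 0 <= M -> 0 < cg_zetahat M eps zeta.
Proof.
case/andP: zeta01 => z0 z1 /cg_kappa_ge2 k2.
by rewrite /cg_zetahat; apply: divr_gt0; lra.
Qed.

Lemma cg_zetahat_le6 M : 0 <= M -> cg_zetahat M eps zeta <= 6^-1.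
Proof.
case/andP: zeta01 => z0 z1 /cg_kappa_ge2 k2.
by rewrite /cg_zetahat ler_pdivrMr; lra.
Qed.

Lemma cg_zetahat_le M M' : 0 <= M -> M <= M' ->
  cg_zetahat M' eps zeta <= cg_zetahat M eps zeta.
Proof.
move=> M0 h; have k2 := cg_kappa_ge2 M0; have kk := cg_kappa_le h.
case/andP: zeta01 => z0 z1; rewrite /cg_zetahat; apply: ler_wpM2l; first exact: ltW.
by rewrite lef_pV2 ?posrE; lra.
Qed.

End Constants.

(** * Conjugate gradient iterations *)

(** The Gram matrix of the family is diagonal and invertible, hence of rank [k],
    and it factors through a space of dimension [m]. *)
Lemma orthogonal_family_le {R : realType} (k m : nat) (w : 'I_k -> 'cV[R]_m) :
  (forall i, w i != 0) -> (forall i j, i != j -> dotv (w i) (w j) = 0) ->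
  (k <= m)%N.
Proof.
move=> w0 ww; pose W := \matrix_(i < k, j < m) w i j 0.
have e : W *m W^T = diag_mx (\row_i dotv (w i) (w i)).
  apply/matrixP => i j; rewrite !mxE.
  have -> : \sum_l W i l * W^T l j = dotv (w i) (w j).
    by rewrite dotvE; apply: eq_bigr => l _; rewrite !mxE.
  case: (eqVneq i j) => [->//|ij].
  by rewrite mulr0n ww.
have u : W *m W^T \in unitmx.
  rewrite e unitmxE det_diag unitfE; apply/prodf_neq0 => i _.
  by rewrite mxE dotvv_eq0.
rewrite -(mxrank_unit u); apply: leq_trans (mxrankM_maxl _ _) _.
exact: rank_leq_col.
Qed.

Section Iterations.
Context {R : realType} {n : nat}.
Variables (H : 'M[R]_n) (g : 'cV[R]_n) (eps M0 : R).
Hypotheses (symH : H^T = H) (eps0 : 0 < eps) (M00 : 0 <= M0) (g0 : g != 0).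

Implicit Types (u v z : 'cV[R]_n) (m : R) (i j k : nat).

Let HB := cg_Hbar H eps.
Let S j := cg_at H g eps M0 j.
Let y j := cg_y (S j).
Let r j := cg_r (S j).
Let p j := cg_p (S j).
Let M j := cg_M (S j).
Let al j := cg_alpha H eps (S j).
Let be j := dotv (r j.+1) (r j.+1) / dotv (r j) (r j).

Lemma symHB : HB^T = HB.
Proof. by rewrite /HB /cg_Hbar linearD /= symH tr_scalar_mx. Qed.

Lemma HBE u : HB *m u = H *m u + (2 * eps) *: u.
Proof. by rewrite /HB /cg_Hbar mulmxDl mul_scalar_mx. Qed.

Let yS j : y j.+1 = y j + al j *: p j. Proof. by []. Qed.
Let rS j : r j.+1 = r j + al j *: (HB *m p j). Proof. by []. Qed.
Let pS j : p j.+1 = - r j.+1 + be j *: p j. Proof. by []. Qed.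

Lemma cg_updM_ge (m : R) u : m <= cg_updM H m u.
Proof.
rewrite /cg_updM; case: ifP => // h.
have [u0|u0] := eqVneq u 0.
  by move: h; rewrite u0 mulmx0 enorm0 mulr0 ltxx.
by rewrite ler_pdivlMr ?enorm_gt0 // ltW.
Qed.

Lemma cg_updM_bound (m : R) u : enorm (H *m u) <= cg_updM H m u * enorm u.
Proof.
rewrite /cg_updM; case: ltP => // h.
have [u0|u0] := eqVneq u 0; first by rewrite u0 mulmx0 enorm0 mulr0.
by rewrite divfK // enorm_eq0.
Qed.

Lemma cg_M_nondecreasing i j : (i <= j)%N -> M i <= M j.
Proof.
elim: j => [|j IH]; first by rewrite leqn0 => /eqP->.
rewrite leq_eqVlt => /predU1P[->//|/IH h]; apply: (le_trans h).
by do 2!apply: (le_trans (cg_updM_ge _ _)); apply: cg_updM_ge.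
Qed.

Lemma cg_M_ge j : M0 <= M j.
Proof. exact: le_trans (cg_updM_ge _ _) (cg_M_nondecreasing (leq0n j)). Qed.

Let Mj0 j : 0 <= M j. Proof. exact: le_trans M00 (cg_M_ge j). Qed.

Lemma cg_M_bound_r i j : (i <= j)%N -> enorm (H *m r i) <= M j * enorm (r i).
Proof.
move=> /cg_M_nondecreasing h.
apply: le_trans (ler_wpM2r (enorm_ge0 _) h).
case: i {h} => [|i]; last exact: cg_updM_bound.
by rewrite -enormN -mulmxN -(enormN (r 0)); apply: cg_updM_bound.
Qed.

Lemma cg_M_bound_y j : enorm (H *m y j) <= M j * enorm (y j).
Proof.
case: j => [|j]; first by rewrite mulmx0 enorm0 mulr0.
by apply: le_trans (cg_updM_bound _ _) (ler_wpM2r (enorm_ge0 _) (cg_updM_ge _ _)).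
Qed.

Lemma kappaE m : cg_kappa m eps * eps = m + 2 * eps.
Proof. by rewrite divfK // gt_eqF. Qed.

Lemma enorm_HB_le m u : enorm (H *m u) <= m * enorm u ->
  enorm (HB *m u) <= cg_kappa m eps * eps * enorm u.
Proof.
move=> h; rewrite HBE kappaE; apply: (le_trans (enormD _ _)).
by rewrite enormZ ger0_norm; [rewrite [leRHS]mulrDl lerD2r|rewrite mulr_ge0 // ltW].
Qed.

(** No breakdown before iteration [k]: the denominators in the step lengths and
    in the coefficients of the directions do not vanish. *)
Definition cg_regular k : Prop :=
  forall i, (i < k)%N -> r i != 0 /\ 0 < quad HB (p i).

Lemma cg_regularW k l : (l <= k)%N -> cg_regular k -> cg_regular l.
Proof. by move=> lk h i il; apply: h; exact: leq_trans lk. Qed.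

(** The invariants of conjugate gradient: residuals are orthogonal to the earlier
    residuals and directions, directions are conjugate.  Since
    [HB *m p a = (r a.+1 - r a) / al a], conjugacy with earlier directions is a
    matter of orthogonality of residuals. *)
Lemma cg_orthogonality k : cg_regular k -> forall a, (a < k)%N ->
  [/\ dotv (r k) (p a) = 0, dotv (r k) (r a) = 0 & dotv (p k) (HB *m p a) = 0].
Proof.
elim: k => // k IH reg.
have {}IH := IH (cg_regularW (leqnSn k) reg).
have [rk0 pk0] := reg k (ltnSn k).
have rr0 : dotv (r k) (r k) != 0 by rewrite dotvv_eq0.
have alE : al k * quad HB (p k) = dotv (r k) (r k).
  by rewrite /al /cg_alpha -/(p k) -/(r k) divfK // gt_eqF.
have rp : dotv (r k) (p k) = - dotv (r k) (r k).
  case: (k) IH => [|j] IH; first by rewrite /p /r /S /= dotvNr.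
  by case: (IH _ (ltnSn j)) => h _ _; rewrite pS dotvDr dotvNr dotvZr h mulr0 addr0.
have rp0 a : (a < k.+1)%N -> dotv (r k.+1) (p a) = 0.
  rewrite ltnS leq_eqVlt rS dotvDl dotvZl => /predU1P[->|ak].
    by rewrite (dotvC (HB *m _)) -/(quad HB (p k)) alE rp addNr.
  case: (IH a ak) => -> _ pp.
  by rewrite -(dotv_mulmxC _ _ symHB) pp mulr0 addr0.
have rr a : (a < k.+1)%N -> dotv (r k.+1) (r a) = 0.
  case: a => [|a] ak.
    by have := rp0 _ ak; rewrite {1}/p /S /= dotvNr => /eqP; rewrite oppr_eq0 => /eqP.
  have -> : r a.+1 = be a *: p a - p a.+1 by rewrite pS opprD opprK addrCA subrr addr0.
  by rewrite dotvBr dotvZr !rp0 ?mulr0 ?subrr // ltnW.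
have HBp a : (a < k.+1)%N -> dotv (r k.+1) (HB *m p a) =
    dotv (r k.+1) (r a.+1) / al a.
  move=> ak; have [ra0 pa0] := reg a ak.
  have al0 : al a != 0.
    by rewrite /al /cg_alpha mulf_neq0 ?invr_eq0 ?dotvv_eq0 // gt_eqF.
  by rewrite [in RHS]rS dotvDr dotvZr rr // add0r mulrC mulKf.
move=> a ak; split; [exact: rp0|exact: rr|].
rewrite pS dotvDl dotvNl dotvZl HBp //.
move: ak; rewrite ltnS leq_eqVlt => /predU1P[->|ak].
  rewrite -/(quad HB (p k)) /al /cg_alpha -/(p k) -/(r k) /be.
  by field; rewrite rr0 gt_eqF.
by have [_ _ ->] := IH a ak; rewrite rr ?ltnS // mul0r oppr0 mulr0 addr0.
Qed.

Lemma dotv_rp k : cg_regular k -> dotv (r k) (p k) = - dotv (r k) (r k).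
Proof.
case: k => [|k] reg; first by rewrite /p /r /S /= dotvNr.
have [rp _ _] := cg_orthogonality reg (ltnSn k).
by rewrite pS dotvDr dotvNr dotvZr rp mulr0 addr0.
Qed.

Lemma cg_residual k : r k = HB *m y k + g.
Proof.
elim: k => [|k IH]; first by rewrite /y /S /= mulmx0 add0r.
by rewrite rS yS IH mulmxDr scalemxAr addrAC.
Qed.

Lemma dotv_ry k a : cg_regular k -> (a <= k)%N -> dotv (r k) (y a) = 0.
Proof.
move=> reg; elim: a => [|a IH] ak; first by rewrite dotv0r.
have [rp _ _] := cg_orthogonality reg ak.
by rewrite yS dotvDr dotvZr rp mulr0 addr0 IH // ltnW.
Qed.

Lemma cg_regularS k : cg_regular k -> r k != 0 -> ~~ neg_curv H eps (p k) ->
  cg_regular k.+1.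
Proof.
move=> reg rk pk i; rewrite ltnS leq_eqVlt => /predU1P[->|]; last exact: reg.
split=> //; rewrite -leNgt in pk; apply: lt_le_trans pk.
rewrite mulr_gt0 // exprn_gt0 // enorm_gt0; apply/eqP => pk0.
have := dotv_rp reg; rewrite pk0 dotv0r => /esym/eqP.
by rewrite oppr_eq0 dotvv_eq0 (negbTE rk).
Qed.

(** By conjugacy [r k] is the sum of two conjugate vectors, one of them
    [- p k]; the bound on the curvature along residuals is thus inherited by the
    directions. *)
Lemma quad_p_le k : cg_regular k -> quad HB (p k) <= quad HB (r k).
Proof.
case: k => [|k] reg; first by rewrite /p /r /S /= quadN.
have [_ _ pp] := cg_orthogonality reg (ltnSn k).
have -> : r k.+1 = be k *: p k - p k.+1 by rewrite pS opprD opprK addrCA subrr addr0.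
rewrite /quad mulmxBr -scalemxAr !(dotvBl, dotvBr) !dotvZl !dotvZr.
have [_ pk] := reg k (ltnSn k).
have pp' : dotv (p k) (HB *m p k.+1) = 0.
  by rewrite (dotv_mulmxC _ _ symHB) dotvC.
rewrite pp pp' -/(quad HB (p k)) !mulr0 subr0 sub0r opprK lerDr.
by rewrite mulrA -expr2 mulr_ge0 ?sqr_ge0 // ltW.
Qed.

Let Phi u := quad HB u / 2 + dotv g u.

Lemma Phi_expand k u : Phi u = Phi (y k) + dotv (r k) (u - y k)
  + quad HB (u - y k) / 2.
Proof.
have e : dotv (y k) (HB *m u) = dotv u (HB *m y k).
  by rewrite (dotv_mulmxC _ _ symHB) dotvC.
rewrite /Phi cg_residual /quad mulmxBr !(dotvBl, dotvBr, dotvDl) e.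
rewrite (dotvC (HB *m y k) u) (dotvC (HB *m y k) (y k)); by field.
Qed.

(** The exact line search along [p i] gains at least as much as a gradient step
    of length the inverse of the largest curvature [cg_kappa (M j) eps * eps]. *)
Lemma Phi_decrease i j : (i <= j)%N -> cg_regular i.+1 ->
  Phi (y i.+1) <= Phi (y i) - enorm (r i) ^+ 2 / (2 * (cg_kappa (M j) eps * eps)).
Proof.
move=> ij reg; have [ri pi] := reg i (ltnSn i).
have regi := cg_regularW (leqnSn i) reg.
have k2 := cg_kappa_ge2 eps0 (Mj0 j).
set L := cg_kappa _ _ * eps.
have L0 : 0 < L by rewrite mulr_gt0 //; lra.
have rr0 : 0 < enorm (r i) ^+ 2 by rewrite exprn_gt0 ?enorm_gt0.
have pL : quad HB (p i) <= L * enorm (r i) ^+ 2.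
  apply: (le_trans (quad_p_le regi)); apply: (le_trans (dotv_le _ _)).
  rewrite expr2 mulrCA ler_wpM2l ?enorm_ge0 //.
  exact: enorm_HB_le (cg_M_bound_r ij).
have alE : al i = enorm (r i) ^+ 2 / quad HB (p i) by rewrite enorm_sqr.
have yE : y i.+1 - y i = al i *: p i by rewrite yS addrC addKr.
rewrite (Phi_expand i (y i.+1)) yE dotvZr quadZ dotv_rp // -enorm_sqr alE.
rewrite -addrA lerD2l.
set q := quad HB (p i) in pi pL *; set s := enorm (r i) ^+ 2 in rr0 pL *.
have -> : s / q * - s + (s / q) ^+ 2 * q / 2 = - (s ^+ 2 / (2 * q)).
  by field; rewrite gt_eqF.
rewrite lerN2.
have q2 : 0 < 2 * q by rewrite mulr_gt0.
have L2 : 0 < 2 * L by rewrite mulr_gt0.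
rewrite ler_pdivlMr // mulrAC ler_pdivrMr //; nra.
Qed.

(** Nesterov's estimate sequence.  [Phi (y i)] stays below the minimum [c] of a
    parabola of curvature [eps] centred at [v], whose value at [z] exceeds
    [Phi z] by at most a multiple of [cg_tau (M j) eps ^+ i].  The next parabola
    is a convex combination of the previous one and of the lower bound at [y i]
    that strong convexity between [y i] and [z] provides.  No extrapolation is
    involved, because [v] and [y i] are combinations of earlier residuals and are
    orthogonal to [r i]. *)
Lemma estimate_sequence j z : cg_regular j.+1 ->
  (forall i, (i < j)%N -> eps * enorm (z - y i) ^+ 2 <= quad HB (z - y i)) ->
  forall i, (i <= j)%N -> exists (c : R) v,
    [/\ Phi (y i) <= c,
        forall k, (i <= k <= j)%N -> dotv (r k) v = 0 &
        c + eps / 2 * enorm (z - v) ^+ 2 <=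
          Phi z + cg_tau (M j) eps ^+ i * (eps / 2 * enorm z ^+ 2 - Phi z)].
Proof.
move=> reg conv; set t := cg_tau _ _.
have t0 : 0 < t by exact: cg_tau_gt0.
have t1 : t < 1 by exact: cg_tau_lt1.
have t1' : 0 < 1 - t by rewrite subr_gt0.
elim=> [|i IH] ij.
  exists 0, 0; split=> [|k _|].
  - by rewrite /y /S /Phi /quad /= dotv0l dotv0r mul0r addr0.
  - by rewrite dotv0r.
  - by rewrite subr0 expr0; lra.
have [c [v [Phic rv cz]]] := IH (ltnW ij).
have regi k : (k <= j)%N -> cg_regular k.+1.
  by move=> kj; apply: cg_regularW reg; rewrite ltnS.
have ry k a : (k <= j)%N -> (a <= k)%N -> dotv (r k) (y a) = 0.
  by move=> kj ak; apply: dotv_ry => //; apply: cg_regularW reg; rewrite leqW.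
(* the minimum of the new parabola *)
pose c' := t * c + (1 - t) * Phi (y i)
  + eps / 2 * (t * (1 - t)) * enorm (y i - v) ^+ 2
  - (1 - t) ^+ 2 * enorm (r i) ^+ 2 / (2 * eps).
exists c', (t *: v + (1 - t) *: (y i - eps^-1 *: r i)); split.
- apply: le_trans (Phi_decrease (ltnW ij) (regi _ (ltnW ij))) _.
  have k2 := cg_kappa_ge2 eps0 (Mj0 j).
  have tk : (1 - t) ^+ 2 * cg_kappa (M j) eps <= 1.
    have sk := sqrtr_ge0 (cg_kappa (M j) eps).
    rewrite /t cg_tauE opprB addrC subrK exprVn mulrC ler_pdivrMr; last first.
      by rewrite exprn_gt0 //; lra.
    have : Num.sqrt (cg_kappa (M j) eps) ^+ 2 = cg_kappa (M j) eps.
      by rewrite sqr_sqrtr //; lra.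
    nra.
  have h : (1 - t) ^+ 2 * enorm (r i) ^+ 2 / (2 * eps) <=
      enorm (r i) ^+ 2 / (2 * (cg_kappa (M j) eps * eps)).
    have k0 : 0 < cg_kappa (M j) eps by lra.
    rewrite ler_pdivlMr; last by apply: mulr_gt0 => //; exact: mulr_gt0.
    have -> : (1 - t) ^+ 2 * enorm (r i) ^+ 2 / (2 * eps) *
      (2 * (cg_kappa (M j) eps * eps)) =
      ((1 - t) ^+ 2 * cg_kappa (M j) eps) * enorm (r i) ^+ 2.
      by field; rewrite gt_eqF.
    by rewrite ler_piMl ?sqr_ge0.
  have h2 : 0 <= eps / 2 * (t * (1 - t)) * enorm (y i - v) ^+ 2.
    apply: mulr_ge0; last exact: sqr_ge0.
    apply: mulr_ge0; first by rewrite divr_ge0 // ltW.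
    by apply: mulr_ge0; rewrite ?subr_ge0 ltW.
  have h3 : t * Phi (y i) <= t * c by rewrite ler_wpM2l // ltW.
  rewrite /c'; lra.
- move=> k /andP[ik kj].
  have [_ rr _] := cg_orthogonality (cg_regularW (leqW kj) reg) ik.
  rewrite dotvDr !dotvZr dotvBr dotvZr rr ry // ?(ltnW ik) // rv.
    by rewrite !mulr0 subrr mulr0 addr0.
  by rewrite (ltnW ik).
- have rvi : dotv (r i) v = 0 by rewrite rv // leqnn ltnW.
  have ryi : dotv (r i) (y i) = 0 by rewrite ry // ltnW.
  have -> : c' + eps / 2 * enorm (z - (t *: v + (1 - t) *: (y i - eps^-1 *: r i)))
      ^+ 2 = t * (c + eps / 2 * enorm (z - v) ^+ 2) + (1 - t) *
      (Phi (y i) + dotv (r i) (z - y i) + eps / 2 * enorm (z - y i) ^+ 2).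
    rewrite /c' !enorm_sqr.
    rewrite !(dotvNl, dotvNr, dotvDl, dotvDr, dotvZl, dotvZr).
    rewrite (dotvC v z) (dotvC (y i) z) (dotvC (y i) v).
    rewrite ?(dotvC v (r i)) ?(dotvC (y i) (r i)) ?(dotvC z (r i)) rvi ryi.
    by field; rewrite gt_eqF.
  have h1 := ler_wpM2l (ltW t0) cz.
  have h2 : Phi (y i) + dotv (r i) (z - y i) + eps / 2 * enorm (z - y i) ^+ 2
      <= Phi z.
    rewrite (Phi_expand i z) lerD2l mulrAC ler_pM2r ?invr_gt0 //; exact: conv.
  have h3 := ler_wpM2l (ltW t1') h2.
  apply: (le_trans (lerD h1 h3)); rewrite (exprS t) le_eqVlt.
  apply/orP; left; apply/eqP.
  by ring.
Qed.

(** If [HB] is strongly convex along all the [y j.+1 - y i], the residuals decrease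
    at an accelerated linear rate: the energy decrease of the step to [y j.+1]
    controls the residual, and [estimate_sequence] at [z := y j.+1] bounds that
    decrease.  A slower decrease of the residuals therefore reveals a direction
    of negative curvature among these differences. *)
Lemma residual_bound j : cg_regular j.+1 ->
  (forall i, (i < j)%N -> ~~ neg_curv H eps (y j.+1 - y i)) ->
  ~~ neg_curv H eps (p j) ->
  enorm (r j) ^+ 2 <=
    2 * cg_kappa (M j) eps * cg_tau (M j) eps ^+ j * enorm g ^+ 2.
Proof.
move=> reg conv convp; set z := y j.+1.
have conv' i : (i < j)%N -> eps * enorm (z - y i) ^+ 2 <= quad HB (z - y i).
  by move=> /conv; rewrite /neg_curv -leNgt.
have k2 := cg_kappa_ge2 eps0 (Mj0 j); set k := cg_kappa _ _ in k2 *.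
have [c [v [Phic _ cz]]] := estimate_sequence reg conv' (leqnn j).
have dec := Phi_decrease (leqnn j) reg; rewrite -/z in dec.
set t := cg_tau _ _ in cz *.
have tj : 0 <= t ^+ j by rewrite exprn_ge0 // ltW // cg_tau_gt0.
have qz : quad HB z = - dotv g z.
  have := dotv_ry reg (leqnn _); rewrite -/z cg_residual -/z dotvDl.
  by rewrite -(dotv_mulmxC _ _ symHB) => /eqP; rewrite addr_eq0 => /eqP.
have ez : eps * enorm z ^+ 2 <= quad HB z.
  case: (posnP j) => [j0|j0]; last by have := conv' 0%N j0; rewrite subr0.
  move: convp; rewrite /z -leNgt j0 yS add0r quadZ enormZ exprMn => h.
  by rewrite real_normK ?num_real // [leLHS]mulrCA ler_wpM2l ?sqr_ge0.
have gz : - dotv g z <= enorm g ^+ 2 / eps.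
  have h1 : - dotv g z <= enorm g * enorm z.
    by rewrite -dotvNl -(enormN g); exact: dotv_le.
  rewrite ler_pdivlMr //; rewrite qz in ez.
  have [zz|z0] := eqVneq (enorm z) 0.
    rewrite zz mulr0 in h1; apply: le_trans (sqr_ge0 (enorm g)).
    by rewrite mulr_le0_ge0 // ltW.
  have zz : 0 < enorm z by rewrite lt_def z0 enorm_ge0.
  have h2 : eps * enorm z <= enorm g.
    by rewrite -(ler_pM2r zz) -mulrA -expr2 (le_trans ez).
  apply: (le_trans (ler_wpM2r (ltW eps0) h1)).
  by rewrite -mulrA (mulrC _ eps) expr2 ler_wpM2l ?enorm_ge0.
have e0 : 0 <= eps / 2 * enorm (z - v) ^+ 2 by rewrite mulr_ge0 ?sqr_ge0 // divr_ge0 // ltW.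
have h : enorm (r j) ^+ 2 / (2 * (k * eps)) <= t ^+ j * (enorm g ^+ 2 / eps).
  have : t ^+ j * (eps / 2 * enorm z ^+ 2 - Phi z) <= t ^+ j * (enorm g ^+ 2 / eps).
    by rewrite ler_wpM2l // /Phi; lra.
  lra.
have k0 : 0 < 2 * (k * eps) by apply: mulr_gt0 => //; apply: mulr_gt0 => //; lra.
rewrite ler_pdivrMr // in h.
apply: (le_trans h); rewrite le_eqVlt; apply/orP; left; apply/eqP.
by field; rewrite gt_eqF.
Qed.

(** The residuals of a regular run are nonzero and mutually orthogonal. *)
Lemma cg_regular_le k : cg_regular k -> (k <= n)%N.
Proof.
move=> reg; apply: (@orthogonal_family_le R k n (fun i : 'I_k => r i)) => [i|i j ij].
  by have [] := reg i (ltn_ord i).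
have aux (a b : 'I_k) : (a < b)%N -> dotv (r b) (r a) = 0.
  move=> ab; have [] // := @cg_orthogonality b _ a ab.
  exact: cg_regularW (ltnW (ltn_ord b)) reg.
case: (ltngtP i j) => [/aux|/aux//|/val_inj e]; first by rewrite dotvC.
by rewrite e eqxx in ij.
Qed.

Section Call.
Variable zeta : R.
Hypothesis zeta01 : 0 < zeta < 1.

Lemma cg_reaches_regular j : cg_reaches H g eps zeta M0 j -> cg_regular j.
Proof.
case=> _ ng nstop; elim: j nstop => // j IH nstop.
have {}IH : cg_regular j.
  by apply: IH => i /andP[i0 ij]; apply: nstop; rewrite i0 ltnW.
case: (posnP j) => [j0|j0].
  by rewrite j0 in IH *; apply: cg_regularS.
have := nstop j; rewrite j0 ltnSn /cg_stops !negb_or => /(_ isT)/and4P[_ t2 t3 _].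
apply: cg_regularS => //; rewrite -ltNge in t2.
rewrite -enorm_gt0; apply: le_lt_trans t2.
by rewrite mulr_ge0 ?enorm_ge0 // ltW // cg_zetahat_gt0 // Mj0.
Qed.

Lemma sqr_powR_half (t : R) j : 0 <= t -> (t `^ (j%:R / 2)) ^+ 2 = t ^+ j.
Proof.
by move=> t0; rewrite -powR_mulrn ?powR_ge0 // -powRrM divfK ?powR_mulrn.
Qed.

(** Some test succeeds by iteration [n], where the residual vanishes at the
    latest; when it is the fourth, [residual_bound] provides the index [i]. *)
Lemma capped_cg_returns : exists d ty hv m, capped_cg H g eps zeta M0 d ty hv m.
Proof.
have [ng|ng] := boolP (neg_curv H eps (- g)).
  by exists (- g), NC, 1%N, M0; exact: CG_initial.
have [|j /andP[j0 st] jmin] := @ex_minnP (fun j => (0 < j)%N &&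
    cg_stops H g eps zeta M0 j).
  apply: contrapT => nst.
  suff : (n.+1 <= n)%N by rewrite ltnn.
  apply: cg_regular_le; apply: cg_reaches_regular; split=> // i /andP[i0 _].
  by apply/negP => st; apply: nst; exists i; rewrite i0.
have reach : cg_reaches H g eps zeta M0 j.
  split=> // i /andP[i0 ij]; apply/negP => sti.
  by have := jmin i; rewrite i0 sti => /(_ isT); rewrite leqNgt ij.
have [t1|t1] := boolP (cg_test1 H g eps M0 j).
  by exists (y j), NC, j.+1, (M j); exact: CG_exit1.
have [t2|t2] := boolP (cg_test2 H g eps zeta M0 j).
  by exists (y j), SOL, j.+1, (M j); exact: CG_exit2 reach t1 t2.
have [t3|t3] := boolP (cg_test3 H g eps M0 j).
  by exists (p j), NC, j.+1, (M j); exact: CG_exit3 reach t1 t2 t3.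
have t4 : cg_test4 H g eps M0 j.
  by move: st; rewrite /cg_stops (negbTE t1) (negbTE t2) (negbTE t3).
suff [i ij nc] : exists2 i, (i < j)%N & neg_curv H eps (y j.+1 - y i).
  exists (y j.+1 - y i), NC, (j.+1 + 0)%N, (M j).
  exact: CG_exit4 reach t1 t2 t3 t4 ij nc (leq0n _).
apply: contrapT => nex.
have reg := cg_reaches_regular reach.
have regS : cg_regular j.+1.
  apply: cg_regularS => //; rewrite -enorm_gt0; rewrite -ltNge in t2.
  apply: le_lt_trans t2.
  by rewrite mulr_ge0 ?enorm_ge0 // ltW // cg_zetahat_gt0 // Mj0.
have := residual_bound regS _ t3.
have tau0 := ltW (cg_tau_gt0 eps0 (Mj0 j)).
move: t4; rewrite /cg_test4 -/(S j) -/(M j) -/(r j) => t4 bound.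
suff : enorm (r j) ^+ 2 < enorm (r j) ^+ 2 by rewrite ltxx.
apply: (le_lt_trans (bound _)) => [i ij|].
  by apply/negP => nc; apply: nex; exists i.
rewrite -ltr_sqr ?nnegrE ?enorm_ge0 // in t4; last first.
  by rewrite !mulr_ge0 ?enorm_ge0 ?sqrtr_ge0 ?powR_ge0.
apply: le_lt_trans t4.
have sqr3 (a b c : R) : (a * b * c) ^+ 2 = a ^+ 2 * b ^+ 2 * c ^+ 2.
  by rewrite !exprMn.
rewrite sqr3 sqr_powR_half // (sqr_sqrtr (cg_T_ge0 _ _)).
apply: ler_wpM2r; first exact: sqr_ge0.
apply: ler_wpM2r; first exact: exprn_ge0.
exact: cg_T_ge.
Qed.

End Call.

End Iterations.

(** * Length and outcome of a call *)

Section IterationBound.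
Context {R : realType}.
Variables (eps zeta : R).
Hypotheses (eps0 : 0 < eps) (zeta01 : 0 < zeta < 1).

(** The inequality of which [cg_J] is the least integer solution; it is solved for
    a real unknown. *)
Definition cg_ok (M x : R) : Prop :=
  Num.sqrt (cg_T M eps) * cg_tau M eps `^ (x / 2) <= cg_zetahat M eps zeta.

(** From [1 - sqrt tau >= (1 - tau) / 2] and [1 - tau = (sqrt kappa + 1)^-1]. *)
Lemma sqrt_cg_T_le M : 0 <= M ->
  Num.sqrt (cg_T M eps) <= 8 * cg_kappa M eps ^+ 3.
Proof.
move=> M0; have k2 := cg_kappa_ge2 eps0 M0; set k := cg_kappa _ _ in k2 *.
have sk0 := sqrtr_ge0 k.
have skE : Num.sqrt k ^+ 2 = k by rewrite sqr_sqrtr //; lra.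
have [t0 t1] := (cg_tau_gt0 eps0 M0, cg_tau_lt1 eps M).
have st0 := sqrtr_ge0 (cg_tau M eps); have st1 := sqrt_tau_lt1 eps M.
have stE : Num.sqrt (cg_tau M eps) ^+ 2 = cg_tau M eps by rewrite sqr_sqrtr // ltW.
have u0 : 0 < 1 - Num.sqrt (cg_tau M eps) by rewrite subr_gt0.
have gap : 1 <= (1 - Num.sqrt (cg_tau M eps)) * (4 * k).
  have a : (1 - cg_tau M eps) * (Num.sqrt k + 1) = 1.
    by rewrite cg_tauE opprB addrC subrK mulVf // gt_eqF // ltr_wpDl.
  have b : 1 - cg_tau M eps <= 2 * (1 - Num.sqrt (cg_tau M eps)).
    by have := sqr_ge0 (1 - Num.sqrt (cg_tau M eps)); lra.
  have c : Num.sqrt k + 1 <= 2 * k by nra.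
  have d : 0 <= Num.sqrt k + 1 by rewrite addr_ge0.
  have := ler_wpM2r d b; rewrite a => e.
  apply: (le_trans e); rewrite -mulrA mulrCA.
  by rewrite ler_wpM2l ?(ltW u0) //; lra.
have k3 : 0 <= 8 * k ^+ 3 by rewrite mulr_ge0 // exprn_ge0 //; lra.
rewrite -(ler_sqr (sqrtr_ge0 _) k3) sqr_sqrtr ?cg_T_ge0 //.
rewrite /cg_T -/k ler_pdivrMr ?exprn_gt0 //.
have : 1 <= ((1 - Num.sqrt (cg_tau M eps)) * (4 * k)) ^+ 2.
  by rewrite -[1](expr1n R 2) ler_sqr ?nnegrE //; lra.
have k4 : 0 <= 4 * k ^+ 4 by rewrite mulr_ge0 // exprn_ge0 //; lra.
move=> h; have := ler_wpM2l k4 h; rewrite mulr1 => h'; apply: (le_trans h').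
by rewrite le_eqVlt; apply/orP; left; apply/eqP; ring.
Qed.

(** From this value on, the exponential dominates: [ln tau] is at most
    [- (sqrt kappa + 1)^-1], and [24 kappa^4 / zeta] is the ratio of the bound
    [8 kappa^3] of [sqrt_cg_T_le] to [cg_zetahat]. *)
Definition cg_J_real (M : R) : R :=
  2 * (Num.sqrt (cg_kappa M eps) + 1) * ln (24 * cg_kappa M eps ^+ 4 / zeta).

Lemma cg_J_real_ok M x : 0 <= M -> cg_J_real M <= x -> cg_ok M x.
Proof.
move=> M0; rewrite /cg_J_real /cg_ok /cg_zetahat.
have k2 := cg_kappa_ge2 eps0 M0; have sT := sqrt_cg_T_le M0.
have t0 := cg_tau_gt0 eps0 M0.
set k := cg_kappa _ _ in k2 sT *; case/andP: zeta01 => z0 z1 hx.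
have s0 : 0 < Num.sqrt k + 1 by rewrite ltr_wpDl ?sqrtr_ge0.
have K0 : 0 < 24 * k ^+ 4 / zeta.
  by apply: divr_gt0 => //; apply: mulr_gt0 => //; apply: exprn_gt0; lra.
have pw : cg_tau M eps `^ (x / 2) <= (24 * k ^+ 4 / zeta)^-1.
  rewrite /powR gt_eqF // -[leRHS]lnK ?posrE ?invr_gt0 // ler_expR.
  have lnt : ln (cg_tau M eps) <= - (Num.sqrt k + 1)^-1.
    have := @le_ln1Dx R (cg_tau M eps - 1).
    by rewrite subrKC ltrBrDr addNr => /(_ t0); rewrite cg_tauE -/k addrAC subrr add0r.
  rewrite lnV ?posrE //.
  have x0 : 0 <= x / 2.
    rewrite divr_ge0 //; apply: le_trans hx; rewrite mulr_ge0 ?mulr_ge0 ?(ltW s0) //.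
    apply: ln_ge0; rewrite ler_pdivlMr // mul1r.
    have : 1 <= k ^+ 4 by apply: exprn_ege1; lra.
    lra.
  apply: (le_trans (ler_wpM2l x0 lnt)); rewrite mulrN lerN2.
  rewrite ler_pdivlMr // ler_pdivlMr //; lra.
have p0 : 0 <= cg_tau M eps `^ (x / 2) by exact: powR_ge0.
have k3 : 0 <= 8 * k ^+ 3 by rewrite mulr_ge0 // exprn_ge0 //; lra.
apply: (le_trans (ler_pM (sqrtr_ge0 _) p0 sT pw)).
by rewrite le_eqVlt; apply/orP; left; apply/eqP; field; rewrite !gt_eqF //; lra.
Qed.

Lemma cg_ok_gt0 M x : 0 <= M -> cg_ok M x -> 0 < x.
Proof.
move=> M0; rewrite /cg_ok ltNge => ok; apply/negP => x0; move: ok; apply/negP.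
rewrite -ltNge; apply: (@lt_le_trans _ _ 1).
  by apply: le_lt_trans (cg_zetahat_le6 eps0 zeta01 M0) _; lra.
rewrite -[leLHS]mulr1; apply: ler_pM => //.
  rewrite -[leLHS]sqrtr1 ler_sqrt ?cg_T_ge0 //.
  by have := cg_T_ge eps0 M0; have := cg_kappa_ge2 eps0 M0; lra.
have := @ger_powR R (cg_tau M eps); rewrite cg_tau_gt0 // ltW ?cg_tau_lt1 //=.
by move=> /(_ isT (x / 2) 0); rewrite powRr0; apply; lra.
Qed.

(** The three constants are monotone in the bound on the Hessian. *)
Lemma cg_ok_le M M' x : 0 <= M -> M <= M' -> 0 <= x -> cg_ok M' x -> cg_ok M x.
Proof.
move=> M0 MM x0; rewrite /cg_ok => h.
apply: le_trans (cg_zetahat_le eps0 zeta01 M0 MM); apply: le_trans h.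
have M'0 := le_trans M0 MM.
apply: ler_pM; rewrite ?sqrtr_ge0 ?powR_ge0 //.
  by rewrite ler_sqrt ?cg_T_ge0 // cg_T_le.
apply: ge0_ler_powR; rewrite ?nnegrE ?(ltW (cg_tau_gt0 eps0 _)) //.
  by rewrite divr_ge0.
exact: cg_tau_le.
Qed.

Lemma cg_J_spec M : 0 <= M -> exists k : nat,
  [/\ cg_J M eps zeta = k%:Z, (0 < k)%N, cg_ok M k%:R & k%:R <= cg_J_real M + 1].
Proof.
move=> M0; pose ok (m : nat) := `[< cg_ok M m%:R >].
have [m okm mle] : exists2 m, ok m & m%:R <= cg_J_real M + 1.
  have B0 : 0 <= cg_J_real M.
    rewrite leNgt; apply/negP => B0.
    have /(cg_ok_gt0 M0) := @cg_J_real_ok M 0 M0 (ltW B0); by rewrite ltxx.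
  have /andP[h1 h2] := truncn_itv B0.
  exists (Num.truncn (cg_J_real M)).+1; first exact/asboolP/cg_J_real_ok/ltW.
  by rewrite -natr1 lerD2r.
have [k /asboolP okk kmin] := @ex_minnP ok (ex_intro _ m okm).
exists k; split=> //.
- rewrite /cg_J; apply: xget_unique.
    split=> [|i ok_i]; first exact: okk.
    have := cg_ok_gt0 M0 ok_i; rewrite ltr0z => i0.
    case: i i0 ok_i => // i _ ok_i; rewrite lez_nat; apply: kmin.
    exact/asboolP.
  move=> j [ok_j jmin]; apply/eqP; rewrite eq_le jmin //=.
  have := cg_ok_gt0 M0 ok_j; rewrite ltr0z.
  case: j ok_j {jmin} => // j ok_j _; rewrite lez_nat; apply: kmin.
  exact/asboolP.
- by have := cg_ok_gt0 M0 okk; rewrite ltr0n.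
- by apply: le_trans mle; rewrite ler_nat kmin.
Qed.

End IterationBound.

Section Outputs.
Context {R : realType} {n : nat}.
Variables (H : 'M[R]_n) (g : 'cV[R]_n) (eps zeta M0 : R).
Hypotheses (symH : H^T = H) (eps0 : 0 < eps) (zeta01 : 0 < zeta < 1).
Hypotheses (M00 : 0 <= M0) (g0 : g != 0).

Lemma capped_cg_M_ge d ty hv m : capped_cg H g eps zeta M0 d ty hv m -> M0 <= m.
Proof. by case=> // *; exact: cg_M_ge. Qed.

(** At iteration [cg_J U eps zeta] either the residual is small enough for the
    second test or it exceeds the threshold of the fourth one. *)
Lemma cg_reaches_le_J j U : cg_reaches H g eps zeta M0 j ->
  cg_M (cg_at H g eps M0 j) <= U -> j%:Z <= cg_J U eps zeta.
Proof.
move=> reach MU.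
have Mj0 i : 0 <= cg_M (cg_at H g eps M0 i) by exact: le_trans M00 (cg_M_ge _ _ _ _ _).
have [k [-> k0 ok _]] := cg_J_spec eps0 zeta01 (le_trans (Mj0 j) MU).
rewrite lez_nat leqNgt; apply/negP => kj.
have MkU := le_trans (cg_M_nondecreasing H g eps M0 (ltnW kj)) MU.
case: reach => _ _ /(_ k); rewrite k0 kj => /(_ isT).
rewrite /cg_stops !negb_or => /and4P[_ + _].
rewrite /cg_test2 /cg_test4 -leNgt -ltNge => t2 t4.
have {}t2 := lt_le_trans t2 t4.
rewrite ltr_pM2r ?enorm_gt0 // in t2.
have := cg_ok_le eps0 zeta01 (Mj0 k) MkU (ler0n R k) ok.
by rewrite /cg_ok leNgt t2.
Qed.

(** Every product but those spent regenerating iterates belongs to an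
    iteration of its own, the first one excepted; regenerating at most doubles
    the count. *)
Lemma capped_cg_cost d ty hv m U : capped_cg H g eps zeta M0 d ty hv m -> m <= U ->
  hv%:Z <= 2 * Num.min n%:Z (cg_J U eps zeta) + 1.
Proof.
move=> call mU.
have U0 : 0 <= U by exact: le_trans M00 (le_trans (capped_cg_M_ge call) mU).
have bound j : cg_reaches H g eps zeta M0 j -> cg_M (cg_at H g eps M0 j) <= U ->
    j%:Z <= Num.min n%:Z (cg_J U eps zeta).
  move=> reach MU; rewrite le_min lez_nat cg_reaches_le_J // andbT.
  exact: cg_regular_le (cg_reaches_regular symH eps0 M00 g0 zeta01 reach).
case: call mU => [_ _|j reach _|j reach _ _|j reach _ _ _|j i e reach _ _ _ _ _ _ ej];
  try by move=> /(bound _ reach); case: reach => j0 _ _; lia.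
have [k [-> k0 _ _]] := cg_J_spec eps0 zeta01 U0; lia.
Qed.

Lemma capped_cg_NC d hv m :
  capped_cg H g eps zeta M0 d NC hv m -> neg_curv H eps d.
Proof. by move E : NC => ty call; case: call E. Qed.

(** The step is orthogonal to its residual, and the relative accuracy with respect
    to [g] turns into one with respect to [d], since [M] bounds the curvature
    along [d]. *)
Lemma capped_cg_SOL d hv m : capped_cg H g eps zeta M0 d SOL hv m ->
  [/\ d != 0, dotv d g = - quad (cg_Hbar H eps) d,
      eps * enorm d ^+ 2 <= quad (cg_Hbar H eps) d &
      enorm (cg_Hbar H eps *m d + g) <= zeta * eps / 2 * enorm d].
Proof.
move E : SOL => ty call; case: call E => // j reach t1 t2 _.
have reg := cg_reaches_regular symH eps0 M00 g0 zeta01 reach.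
set d' := cg_y _; set r := cg_r (cg_at H g eps M0 j).
have Mj0 : 0 <= cg_M (cg_at H g eps M0 j) by exact: le_trans M00 (cg_M_ge _ _ _ _ _).
have rE : r = cg_Hbar H eps *m d' + g by exact: cg_residual.
have z6 := cg_zetahat_le6 eps0 zeta01 Mj0.
have z0 := cg_zetahat_gt0 eps0 zeta01 Mj0.
have gp : 0 < enorm g by rewrite enorm_gt0.
move: t2; rewrite /cg_test2 -/r => t2.
have rd : dotv r d' = 0 by have := dotv_ry symH reg (leqnn j).
have k2 := cg_kappa_ge2 eps0 Mj0.
have HBd := enorm_HB_le eps0 (cg_M_bound_y H g eps M0 j); rewrite -/d' in HBd.
have res : enorm r <= zeta * eps / 2 * enorm d'.
  have gr : enorm g <= enorm r + enorm (cg_Hbar H eps *m d').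
    have -> : g = r + - (cg_Hbar H eps *m d') by rewrite rE addrAC subrr add0r.
    by rewrite -(enormN (_ *m _)) enormD.
  have zk : cg_zetahat (cg_M (cg_at H g eps M0 j)) eps zeta *
      cg_kappa (cg_M (cg_at H g eps M0 j)) eps = zeta / 3.
    by rewrite /cg_zetahat; field; rewrite gt_eqF //; lra.
  set zh := cg_zetahat _ _ _ in z6 z0 t2 zk; set k := cg_kappa _ _ in k2 HBd zk.
  have r0 := enorm_ge0 r; have d0 := enorm_ge0 d'.
  have h1 : zh * enorm g <= zh * (enorm r + k * eps * enorm d').
    by rewrite ler_wpM2l ?(ltW z0) // (le_trans gr) // lerD2l.
  have h2 : zh * (enorm r + k * eps * enorm d') =
      zh * enorm r + zeta / 3 * eps * enorm d'.
    by rewrite -zk; ring.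
  have h3 : zh * enorm r <= 6^-1 * enorm r by rewrite ler_wpM2r.
  have h4 : 0 <= zeta * eps * enorm d'.
    by case/andP: zeta01 => ? _; rewrite mulr_ge0 // mulr_ge0 // ltW.
  lra.
split.
- apply/eqP => d0; move: t2.
  have -> : r = g by rewrite rE d0 mulmx0 add0r.
  by rewrite leNgt => /negP; apply; rewrite gtr_pMl //; lra.
- move: rd; rewrite rE dotvDl => /eqP; rewrite addr_eq0 => /eqP.
  by rewrite dotvC => e; rewrite (dotvC _ g) /quad e opprK.
- by move: t1; rewrite /cg_test1 /neg_curv -leNgt.
- by rewrite -rE.
Qed.

End Outputs.

(** * Descent at one iterate *)

Section Steps.
Context {R : realType} {n : nat}.
Variables (f : 'cV[R]_n -> R) (N : set 'cV[R]_n) (x0 : 'cV[R]_n).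
Variables (L_H eps theta zeta eta : R).
Hypotheses (hf : twice_lipschitz_differentiable N f L_H) (oN : open N).
Hypotheses (cl : closed (level_set f x0)) (sub : level_set f x0 `<=` N).
Hypotheses (L0 : 0 <= L_H) (eps0 : 0 < eps) (theta01 : 0 < theta < 1).
Hypotheses (zeta01 : 0 < zeta < 1) (eta0 : 0 < eta).
Variable (x : 'cV[R]_n).
Hypothesis lx : level_set f x0 x.

Let g := grad f x.
Let H := hess f x.

Lemma L_eta_gt0 : 0 < L_H + eta. Proof. exact: ltr_wpDl. Qed.

(** The first premise keeps the segment inside the neighbourhood, where the cubic
    model bounds [f]; the second one is sufficient decrease of the model. *)
Lemma model_descent d (a : R) : 0 <= a ->
  (forall s, 0 <= s <= a -> s * dotv d g + s ^+ 2 / 2 * quad H d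
     + L_H / 6 * s ^+ 3 * enorm d ^+ 3 <= 0) ->
  a * dotv d g + a ^+ 2 / 2 * quad H d + L_H / 6 * a ^+ 3 * enorm d ^+ 3
    < - (eta / 6 * a ^+ 3 * enorm d ^+ 3) ->
  f (x + a *: d) < f x - eta / 6 * a ^+ 3 * enorm d ^+ 3.
Proof.
move=> a0 model strict; have seg := segment_in hf oN cl sub lx model.
apply: (le_lt_trans (f_taylor_le hf a0 seg)); rewrite -/g -/H; lra.
Qed.

Lemma exists_small_step (A : R) : 0 < A -> exists j, theta ^+ j < A.
Proof.
case/andP: theta01 => t0 t1 A0.
have /cvgrPdist_lt/(_ _ A0) : theta ^+ n @[n --> \oo] --> (0 : R).
  by apply: cvg_expr; rewrite gtr0_norm.
case=> j _ /(_ j (leqnn j)); rewrite /= sub0r normrN ger0_norm ?exprn_ge0 ?ltW //.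
by exists j.
Qed.

Lemma theta_exp_gt0 j : 0 < theta ^+ j.
Proof. by case/andP: theta01 => t0 _; exact: exprn_gt0. Qed.

Lemma theta_exp_le1 j : theta ^+ j <= 1.
Proof. by case/andP: theta01 => t0 t1; rewrite exprn_ile1 // ltW. Qed.

Section NegativeCurvature.
Variable d : 'cV[R]_n.
Hypotheses (d0 : d != 0) (gd : dotv d g <= 0).
Hypothesis Hd : quad H d = - enorm d ^+ 3.

(** Along [d] the model is at most
    [(- 1 / 2 + a * L_H / 6) * a ^+ 2 * enorm d ^+ 3]. *)
Lemma nc_accept (a : R) : 0 < a -> a < 3 / (L_H + eta) ->
  f (x + a *: d) < f x - eta / 6 * a ^+ 3 * enorm d ^+ 3.
Proof.
move=> a0; rewrite ltr_pdivlMr ?L_eta_gt0 // => aL.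
have D3 : 0 < enorm d ^+ 3 by rewrite exprn_gt0 ?enorm_gt0.
have e0 := eta0; have l0 := L0.
have key s : 0 <= s -> s * dotv d g <= 0 by move=> s0; rewrite mulr_ge0_le0.
apply: model_descent; first exact: ltW.
- move=> s /andP[s0 sa]; rewrite Hd.
  have h : s * L_H <= 3.
    have : s * L_H <= a * L_H by rewrite ler_wpM2r.
    have : 0 <= a * eta by rewrite mulr_ge0 // ltW.
    lra.
  have h2 := mulr_ge0 (sqr_ge0 s) (ltW D3).
  have h3 : s ^+ 2 * enorm d ^+ 3 * (s * L_H - 3) <= 0 by rewrite mulr_ge0_le0 //; lra.
  by have := key s s0; lra.
- rewrite Hd.
  have h2 := mulr_gt0 (exprn_gt0 2 a0) D3.
  have h3 : a ^+ 2 * enorm d ^+ 3 * (a * (L_H + eta) - 3) < 0.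
    by rewrite pmulr_rlt0 //; lra.
  by have := key a (ltW a0); lra.
Qed.

Lemma nc_ls_accepts : exists j, ls_accept f theta eta x d j.
Proof.
have A0 : 0 < 3 / (L_H + eta) by rewrite divr_gt0 ?L_eta_gt0.
have [j jA] := exists_small_step A0; exists j.
by apply: nc_accept jA; exact: theta_exp_gt0.
Qed.

Lemma nc_step_ge j : ls_tries f theta eta x d j ->
  Num.min 1 (27 * theta ^+ 3 / (L_H + eta) ^+ 3) <= (theta ^+ j) ^+ 3.
Proof.
case: j => [|j] tries; first by rewrite expr0 expr1n ge_min lexx.
have : 3 / (L_H + eta) <= theta ^+ j.
  rewrite leNgt; apply/negP => /(nc_accept (theta_exp_gt0 j)) acc.
  by have /negP := tries j (ltnSn j); apply.
move=> h; rewrite ge_min; apply/orP; right.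
have -> : 27 * theta ^+ 3 / (L_H + eta) ^+ 3 = (theta * (3 / (L_H + eta))) ^+ 3.
  by field; rewrite gt_eqF // L_eta_gt0.
case/andP: theta01 => t0 t1; rewrite (exprS theta).
have a0 : 0 <= 3 / (L_H + eta) by rewrite divr_ge0 // ltW // L_eta_gt0.
have tj := theta_exp_gt0 j.
apply: lerXn2r; rewrite ?nnegrE; first by rewrite mulr_ge0 // ltW.
  by rewrite mulr_ge0 // ltW.
by rewrite ler_wpM2l // ltW.
Qed.

Lemma nc_decrease j : ls_tries f theta eta x d j -> ls_accept f theta eta x d j ->
  eps <= enorm d ->
  f (x + theta ^+ j *: d) < f x - c_nc theta eta L_H * eps ^+ 3.
Proof.
move=> tries acc deps; apply: (lt_le_trans acc).
rewrite lerD2l lerN2 /c_nc -[leLHS]mulrA -[leRHS]mulrA.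
apply: ler_wpM2l; first by rewrite divr_ge0 // ltW.
apply: ler_pM.
- rewrite le_min ler01 /= divr_ge0 ?exprn_ge0 ?(ltW L_eta_gt0) //.
  by case/andP: theta01 => /ltW t0 _; rewrite mulr_ge0 // exprn_ge0.
- by rewrite exprn_ge0 // ltW.
- exact: nc_step_ge.
- by rewrite lerXn2r ?nnegrE ?enorm_ge0 // ltW.
Qed.

End NegativeCurvature.

Section NewtonStep.
Variable d : 'cV[R]_n.
Hypotheses (d0 : d != 0) (gd : dotv d g = - quad (cg_Hbar H eps) d).
Hypothesis Hd : eps * enorm d ^+ 2 <= quad (cg_Hbar H eps) d.
Hypothesis res : enorm (cg_Hbar H eps *m d + g) <= zeta * eps / 2 * enorm d.

Lemma quad_cg_Hbar : quad (cg_Hbar H eps) d = quad H d + 2 * eps * enorm d ^+ 2.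
Proof. by rewrite /quad HBE dotvDr dotvZr enorm_sqr. Qed.

(** Here [b] is [L_H] for the model itself, or [L_H + eta] for the model augmented
    with the decrease asked for by the line search. *)
Lemma sol_model (s b : R) : 0 <= s <= 1 -> 0 <= b ->
  b * s ^+ 2 * enorm d <= 3 * eps ->
  s * dotv d g + s ^+ 2 / 2 * quad H d + b / 6 * s ^+ 3 * enorm d ^+ 3
    <= s * (b * s ^+ 2 * enorm d - 3 * eps) * enorm d ^+ 2 / 6.
Proof.
move=> /andP[s0 s1] b0 hb; rewrite gd.
have -> : quad H d = quad (cg_Hbar H eps) d - 2 * eps * enorm d ^+ 2.
  by rewrite quad_cg_Hbar addrK.
have hQ := Hd; set Q := quad _ d in hQ *; have D0 := enorm_ge0 d.
set D := enorm d in hQ hb D0 *; have ep := eps0.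
have h1 : 0 <= s * (1 - s / 2) * (Q - eps * D ^+ 2).
  by rewrite mulr_ge0 ?mulr_ge0 ?subr_ge0 //; lra.
have h2 : 0 <= s ^+ 2 * (eps * D ^+ 2) by rewrite !mulr_ge0 ?sqr_ge0 ?(ltW eps0).
have h3 : 0 <= s * (eps * D ^+ 2) by rewrite !mulr_ge0 ?sqr_ge0 ?(ltW eps0).
lra.
Qed.

Lemma sol_segment (a : R) : 0 <= a <= 1 -> (L_H + eta) * a ^+ 2 * enorm d < 3 * eps ->
  forall s : R, 0 <= s <= a -> N (x + s *: d).
Proof.
move=> /andP[a0 a1] ha; apply: segment_in hf oN cl sub lx _ => s /andP[s0 sa].
have h : L_H * s ^+ 2 * enorm d <= 3 * eps.
  apply: le_trans (ltW ha); rewrite ler_wpM2r ?enorm_ge0 //.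
  by apply: ler_pM; rewrite ?sqr_ge0 // ?lerDl ?(ltW eta0) // lerXn2r.
have s1 : 0 <= s <= 1 by rewrite s0 (le_trans sa).
apply: (le_trans (sol_model s1 L0 h)).
rewrite pmulr_lle0 ?invr_gt0 // mulr_le0_ge0 ?sqr_ge0 // mulr_ge0_le0 //.
by rewrite subr_le0.
Qed.

Lemma sol_accept (a : R) : 0 < a <= 1 -> (L_H + eta) * a ^+ 2 * enorm d < 3 * eps ->
  f (x + a *: d) < f x - eta / 6 * a ^+ 3 * enorm d ^+ 3.
Proof.
move=> /andP[a0 a1] ha; have a01 : 0 <= a <= 1 by rewrite ltW.
have seg := sol_segment a01 ha.
apply: (le_lt_trans (f_taylor_le hf (ltW a0) seg)); rewrite -/g -/H.
have := sol_model a01 (ltW L_eta_gt0) (ltW ha).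
have : a * ((L_H + eta) * a ^+ 2 * enorm d - 3 * eps) * enorm d ^+ 2 / 6 < 0.
  rewrite pmulr_llt0 ?invr_gt0 // pmulr_llt0 ?exprn_gt0 ?enorm_gt0 //.
  by rewrite pmulr_rlt0 // subr_lt0.
lra.
Qed.

Lemma sol_ls_accepts : exists j, ls_accept f theta eta x d j.
Proof.
have dp : 0 < enorm d by rewrite enorm_gt0.
have LD : 0 < (L_H + eta) * enorm d by rewrite mulr_gt0 ?L_eta_gt0.
have A0 : 0 < 3 * eps / ((L_H + eta) * enorm d).
  by rewrite divr_gt0 // mulr_gt0.
have [j jA] := exists_small_step A0; exists j.
apply: sol_accept; first by rewrite theta_exp_gt0 theta_exp_le1.
rewrite mulrAC mulrC -ltr_pdivlMr //; apply: le_lt_trans jA.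
by rewrite expr2 ler_piMr ?theta_exp_le1 // ltW // theta_exp_gt0.
Qed.

(* the two quantities whose cubes enter [c_sol] *)
Let cA : R := 4 / (Num.sqrt ((4 + zeta) ^+ 2 + 8 * L_H) + 4 + zeta).
Let cB : R := 3 * theta ^+ 2 * (1 - zeta) / (L_H + eta).

(** [cA] is the positive root of the quadratic to which the bound on the new
    gradient leads. *)
Lemma cA_root : 0 < cA /\ L_H * cA ^+ 2 + (4 + zeta) * cA = 2.
Proof.
case/andP: zeta01 => z0 z1.
have l0 := L0.
have p0 : 0 <= (4 + zeta) ^+ 2 + 8 * L_H by rewrite addr_ge0 ?sqr_ge0 // mulr_ge0.
have s0 := sqrtr_ge0 ((4 + zeta) ^+ 2 + 8 * L_H).
have sE := sqr_sqrtr p0; rewrite /cA; set s := Num.sqrt _ in s0 sE *.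
have q0 : 0 < s + 4 + zeta by lra.
split; first by rewrite divr_gt0.
apply/eqP; rewrite -subr_eq0; apply/eqP.
have -> : L_H * (4 / (s + 4 + zeta)) ^+ 2 + (4 + zeta) * (4 / (s + 4 + zeta)) - 2
  = 2 * ((4 + zeta) ^+ 2 + 8 * L_H - s ^+ 2) / (s + 4 + zeta) ^+ 2.
  by field; rewrite gt_eqF.
by rewrite sE subrr mulr0 mul0r.
Qed.

Lemma cB_ge0 : 0 <= cB.
Proof.
case/andP: zeta01 => z0 z1; apply: divr_ge0; last exact: ltW L_eta_gt0.
by rewrite mulr_ge0 ?subr_ge0 ?(ltW z1) // mulr_ge0 ?sqr_ge0.
Qed.

(** The new gradient is at most [L_H / 2 * enorm d ^+ 2] plus the residual of the
    undamped Newton system, so that a large new gradient forces a long step. *)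
Lemma sol_unit_step eg : 0 < eg -> eg < enorm (grad f (x + d)) ->
  (forall s : R, 0 <= s <= 1 -> N (x + s *: d)) ->
  cA * Num.min (eg / eps) eps <= enorm d.
Proof.
move=> eg0 egG seg; have [A0 AE] := cA_root.
set m := Num.min _ _.
have m0 : 0 < m by rewrite lt_min eps0 divr_gt0.
have m1 : m <= eps by rewrite ge_min lexx orbT.
have m2 : eps * m <= eg.
  by rewrite mulrC -ler_pdivlMr // ge_min lexx.
have D0 := enorm_ge0 d.
have gb : 2 * eg < L_H * enorm d ^+ 2 + (4 + zeta) * eps * enorm d.
  have h1 := grad_error_le hf L0 seg.
  have h2 := res.
  have h3 : enorm (2 * eps *: d) = 2 * eps * enorm d.
    by rewrite enormZ ger0_norm // mulr_ge0 // ltW.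
  have e : grad f (x + d) = (grad f (x + d) - (g + H *m d)) +
     ((cg_Hbar H eps *m d + g) - (2 * eps) *: d).
    rewrite HBE (addrAC (H *m d)) addrK (addrC (H *m d)) subrK //.
  move: egG; rewrite e => egG.
  have h4 := enormD (grad f (x + d) - (g + H *m d))
     ((cg_Hbar H eps *m d + g) - (2 * eps) *: d).
  have h5 := enormD (cg_Hbar H eps *m d + g) (- ((2 * eps) *: d)).
  rewrite enormN h3 in h5; rewrite -/g -/H in h1; lra.
rewrite leNgt; apply/negP => lt.
have l0 := L0; have ep := eps0; case/andP: zeta01 => z0 z1.
have Am : 0 <= cA * m by rewrite mulr_ge0 // ltW.
have h1 : L_H * enorm d ^+ 2 <= L_H * (cA * m) ^+ 2.
  by apply: ler_wpM2l => //; apply: lerXn2r; rewrite ?nnegrE // ltW.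
have h2 : (4 + zeta) * eps * enorm d <= (4 + zeta) * eps * (cA * m).
  by rewrite ler_wpM2l ?ltW // mulr_gt0 //; lra.
have h3 : L_H * (cA * m) ^+ 2 <= L_H * cA ^+ 2 * eg.
  rewrite exprMn mulrA; apply: ler_wpM2l; first by rewrite mulr_ge0 ?sqr_ge0.
  by apply: le_trans m2; rewrite expr2; apply: ler_wpM2r => //; exact: ltW.
have h4 : (4 + zeta) * eps * (cA * m) <= (4 + zeta) * cA * eg.
  have -> : (4 + zeta) * eps * (cA * m) = (4 + zeta) * cA * (eps * m) by ring.
  by rewrite ler_wpM2l // mulr_ge0 ?(ltW A0) //; lra.
have h5 : L_H * cA ^+ 2 * eg + (4 + zeta) * cA * eg = 2 * eg by rewrite -mulrDl AE.
lra.
Qed.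

Lemma cB_le u : 3 * eps <= (L_H + eta) * u -> cB * eps <= theta * u.
Proof.
move=> h; case/andP: theta01 => t0 t1; case/andP: zeta01 => z0 z1.
have Lp := L_eta_gt0.
have -> : cB * eps = theta * (theta * (1 - zeta) * (3 * eps)) / (L_H + eta).
  by rewrite /cB; field; rewrite gt_eqF.
rewrite ler_pdivrMr // -[leRHS]mulrA; apply: ler_wpM2l; first exact: ltW.
rewrite (mulrC u); apply: le_trans h.
apply: ler_piMl; first by rewrite mulr_ge0 // ltW.
by apply: mulr_ile1; lra.
Qed.

(** If some trial is rejected, or if the segment of the unit step may leave the
    neighbourhood, then the premise of [sol_accept] fails at the unit step, so
    that [d] is long, whence the bound with [cB].  Otherwise the unit step is
    taken inside the neighbourhood and [sol_unit_step] applies. *)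
Lemma sol_decrease eg j : 0 < eg ->
  ls_tries f theta eta x d j -> ls_accept f theta eta x d j ->
  eg < enorm (grad f (x + theta ^+ j *: d)) ->
  f (x + theta ^+ j *: d) <
    f x - c_sol theta zeta eta L_H * Num.min (eg / eps) eps ^+ 3.
Proof.
move=> eg0 tries acc egG; set m := Num.min _ _.
have m0 : 0 < m by rewrite lt_min eps0 divr_gt0.
have m1 : m <= eps by rewrite ge_min lexx orbT.
have [A0 _] := cA_root; have B0 := cB_ge0.
have tj := theta_exp_gt0 j; have D0 := enorm_ge0 d.
apply: (lt_le_trans acc); rewrite lerD2l lerN2 /c_sol -/cA -/cB.
rewrite -[leLHS]mulrA -[leRHS]mulrA -exprMn.
apply: ler_wpM2l; first by rewrite divr_ge0 // ltW.
suff : cA * m <= theta ^+ j * enorm d \/ cB * m <= theta ^+ j * enorm d.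
  have tD : 0 <= theta ^+ j * enorm d by rewrite mulr_ge0 // ltW.
  have m3 : 0 <= m ^+ 3 by rewrite exprn_ge0 // ltW.
  have via u : 0 <= u -> Num.min (cA ^+ 3) (cB ^+ 3) <= u ^+ 3 ->
      u * m <= theta ^+ j * enorm d ->
      Num.min (cA ^+ 3) (cB ^+ 3) * m ^+ 3 <= (theta ^+ j * enorm d) ^+ 3.
    move=> u0 hu um; apply: (le_trans (ler_wpM2r m3 hu)); rewrite -exprMn.
    by apply: lerXn2r; rewrite ?nnegrE // mulr_ge0 // ltW.
  by case; apply: via; rewrite ?(ltW A0) // ge_min lexx ?orbT.
have rejected i : (i < j)%N -> 3 * eps <= (L_H + eta) * (theta ^+ i) ^+ 2 * enorm d.
  move=> ij; rewrite leNgt; apply/negP => h.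
  have /negP := tries i ij; apply; apply: sol_accept h.
  by rewrite theta_exp_gt0 theta_exp_le1.
have viaB u : theta * u <= theta ^+ j * enorm d ->
    3 * eps <= (L_H + eta) * u -> cB * m <= theta ^+ j * enorm d.
  move=> hu /cB_le h; apply: le_trans hu; apply: le_trans h.
  by rewrite ler_wpM2l.
case: j => [|j] in tries acc egG tj rejected viaB *.
  have [big|small] := leP (3 * eps) ((L_H + eta) * enorm d).
    right; apply: viaB big; rewrite expr0 ler_wpM2r //.
    by case/andP: theta01 => _ /ltW.
  left; rewrite expr0 mul1r; apply: sol_unit_step => //.
    by move: egG; rewrite expr0 scale1r.
  by apply: sol_segment; rewrite ?ler01 ?lexx // expr1n mulr1.
right; apply: (viaB (theta ^+ j * enorm d)); first by rewrite exprS mulrA.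
have u0 := ltW (theta_exp_gt0 j); have Lp := L_eta_gt0.
(* the square of the wanted bound is the product of those at steps 0 and j *)
have r1 := rejected 0%N isT; have r2 := rejected j (ltnSn j).
rewrite expr0 expr1n mulr1 in r1.
have e0 : 0 <= 3 * eps by rewrite mulr_ge0 // ltW.
have p0 : 0 <= (L_H + eta) * (theta ^+ j * enorm d) by rewrite !mulr_ge0 // ltW.
rewrite -ler_sqr ?nnegrE //.
have := ler_pM e0 e0 r1 r2; rewrite -expr2 => h; apply: (le_trans h).
by rewrite le_eqVlt; apply/orP; left; apply/eqP; ring.
Qed.

End NewtonStep.

(** The rescaling gives a direction whose curvature is exactly minus the cube of
    its length, and whose length is at least [eps] since the curvature of [H]
    along [d] is below [- eps]. *)
Lemma nc_directionP d : neg_curv H eps d ->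
  let e := nc_direction f x d in
  [/\ dotv e g <= 0, quad H e = - enorm e ^+ 3 & eps <= enorm e].
Proof.
move=> nc e; rewrite /neg_curv in nc.
have d0 : d != 0.
  apply/eqP => d0; move: nc.
  by rewrite d0 /quad mulmx0 dotv0r enorm0 expr0n /= mulr0 ltxx.
have dp : 0 < enorm d by rewrite enorm_gt0.
have q1 : quad H d < - (eps * enorm d ^+ 2).
  by move: nc; rewrite quad_cg_Hbar; lra.
have q0 : quad H d < 0.
  by apply: lt_trans q1 _; rewrite oppr_lt0 mulr_gt0 // exprn_gt0.
set c := `|quad H d| / enorm d ^+ 2.
have cE : c * enorm d ^+ 2 = - quad H d.
  by rewrite /c divfK ?ltr0_norm // expf_neq0 // gt_eqF.
have ceps : eps <= c.
  by rewrite /c ler_pdivlMr ?exprn_gt0 // ltr0_norm // ltW //; lra.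
have c0 : 0 < c by exact: lt_le_trans ceps.
have eE : e = - (sgn1 (dotv d g) * c / enorm d) *: d.
  by rewrite /e /nc_direction -/g -/H -/c scalerA mulNr.
have s2 : sgn1 (dotv d g) ^+ 2 = 1 by rewrite /sgn1; case: ifP => _; rewrite ?sqrrN expr1n.
have sg : 0 <= sgn1 (dotv d g) * dotv d g.
  by rewrite /sgn1; case: ltP => h; rewrite ?mulN1r ?mul1r // oppr_ge0 ltW.
have ne : enorm e = c.
  have dV : 0 <= (enorm d)^-1 by rewrite invr_ge0 ltW.
  rewrite eE enormZ normrN (normrM (_ * c)) (normrM _ c) (gtr0_norm c0).
  rewrite (ger0_norm dV).
  have -> : `|sgn1 (dotv d g)| = 1.
    by rewrite /sgn1; case: ifP => _; rewrite ?normrN normr1.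
  by rewrite mul1r divfK // gt_eqF.
split; last by rewrite ne.
  rewrite eE dotvZl mulNr oppr_le0 -(mulrA (sgn1 _)) mulrAC mulr_ge0 //.
  by rewrite divr_ge0 // ltW.
rewrite ne eE quadZ sqrrN exprMn (exprMn _ (sgn1 _)) s2 mul1r exprVn.
have -> : quad H d = - (c * enorm d ^+ 2) by rewrite cE opprK.
by field; rewrite gt_eqF.
Qed.

End Steps.

(** * Size of the bound *)

Section Complexity.
Context {R : realType}.
Variables (theta zeta eta L_H U_H Delta : R).
Hypotheses (theta0 : 0 < theta) (zeta01 : 0 < zeta < 1) (eta0 : 0 < eta).
Hypotheses (L0 : 0 <= L_H) (U0 : 0 <= U_H) (Delta0 : 0 <= Delta).

Let c := Num.min (c_sol theta zeta eta L_H) (c_nc theta eta L_H).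
Let decay (eg eH : R) := Num.max (eg ^- 3 * eH ^+ 3) (eH ^- 3).

Lemma step_constant_gt0 : 0 < c.
Proof.
case/andP: zeta01 => z0 z1.
have Lp : 0 < L_H + eta by exact: ltr_wpDl.
have e6 : 0 < eta / 6 by rewrite divr_gt0.
have s0 : 0 < Num.sqrt ((4 + zeta) ^+ 2 + 8 * L_H) + 4 + zeta.
  by have := sqrtr_ge0 ((4 + zeta) ^+ 2 + 8 * L_H); lra.
rewrite lt_min /c_sol /c_nc; apply/andP; split; apply: mulr_gt0 => //.
  rewrite lt_min; apply/andP; split; apply: exprn_gt0; apply: divr_gt0 => //.
  by rewrite mulr_gt0 ?subr_gt0 // mulr_gt0 // exprn_gt0.
by rewrite lt_min ltr01 /= divr_gt0 ?exprn_gt0 // mulr_gt0 // exprn_gt0.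
Qed.

(** [K1bar] is the number of decreases by [c * Num.min (eg / eH) eH ^+ 3] that add
    up to [Delta], because [decay eg eH] is at least the inverse of that cube. *)
Lemma K1bar_ge (a eg eH : R) : 0 < eg -> 0 < eH ->
  a * (c * Num.min (eg / eH) eH ^+ 3) <= Delta ->
  a <= (K1bar theta zeta eta L_H Delta eg eH)%:~R.
Proof.
move=> eg0 eH0 h; apply: le_trans (ceil_ge _); rewrite -/c -/(decay eg eH).
have c0 := step_constant_gt0; set m := Num.min _ _ in h.
have m0 : 0 < m by rewrite lt_min eH0 divr_gt0.
have md : (m ^+ 3)^-1 <= decay eg eH.
  rewrite /decay /m; case: (leP (eg / eH) eH) => _; rewrite le_max; apply/orP.
    left; rewrite le_eqVlt; apply/orP; left; apply/eqP.
    by field; rewrite !gt_eqF.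
  by right.
have m3 : 0 < m ^+ 3 by exact: exprn_gt0.
have : a <= Delta / c / m ^+ 3.
  by rewrite ler_pdivlMr // ler_pdivlMr // -mulrA (mulrC _ c).
by move=> h2; apply: (le_trans h2); rewrite ler_wpM2l // divr_ge0 // ltW.
Qed.

Lemma K1bar_gt (a eg eH : R) : 0 < eg -> 0 < eH ->
  a * (c * Num.min (eg / eH) eH ^+ 3) < Delta ->
  a < (K1bar theta zeta eta L_H Delta eg eH)%:~R.
Proof.
move=> eg0 eH0 h; set cm := c * _ in h.
have cm0 : 0 < cm.
  by rewrite mulr_gt0 ?step_constant_gt0 // exprn_gt0 // lt_min eH0 divr_gt0.
apply: (@lt_le_trans _ _ (Delta / cm)); first by rewrite ltr_pdivlMr.
by apply: K1bar_ge => //; rewrite -/cm divfK // gt_eqF.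
Qed.

Lemma decay_ge1 eg eH : 0 < eH < 1 -> 1 <= decay eg eH.
Proof.
move=> /andP[e0 e1]; rewrite le_max; apply/orP; right.
by rewrite invf_ge1 ?exprn_gt0 // exprn_ile1 // ltW.
Qed.

Lemma K1bar_ge0 eg eH : 0 < eH < 1 ->
  (0 <= K1bar theta zeta eta L_H Delta eg eH)%R.
Proof.
move=> eH01; rewrite /K1bar -/c -/(decay eg eH) -(ler_int R).
apply: le_trans (ceil_ge _); rewrite mulr_ge0 //.
  by rewrite divr_ge0 // ltW // step_constant_gt0.
exact: le_trans ler01 (decay_ge1 _ eH01).
Qed.

Lemma K1bar_le eg eH : 0 < eH < 1 ->
  (K1bar theta zeta eta L_H Delta eg eH)%:~R + 1 <= (Delta / c + 2) * decay eg eH.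
Proof.
move=> eH01; have d1 := decay_ge1 eg eH01.
have /andP[+ _] := ceil_itv (Delta / c * decay eg eH).
by rewrite /K1bar -/c -/(decay eg eH) intrB; lra.
Qed.

(** The condition number is at most [(U_H + 2) / eH]. *)
Lemma cg_J_real_le eH : 0 < eH < 1 ->
  cg_J_real eH zeta U_H <= 2 * (Num.sqrt (U_H + 2) + 1) *
   (ln (24 * (U_H + 2) ^+ 4 / zeta) + 4) * (Num.sqrt eH)^-1 * (1 + `|ln eH|).
Proof.
move=> /andP[e0 e1]; case/andP: zeta01 => z0 z1.
have k2 := cg_kappa_ge2 e0 U0; set k := cg_kappa _ _ in k2 *.
have kU : k <= (U_H + 2) / eH.
  by rewrite /k /cg_kappa ler_pM2r ?invr_gt0 // lerD2l; lra.
set e := (Num.sqrt eH)^-1.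
have se : 0 < Num.sqrt eH by rewrite sqrtr_gt0.
have e_ge1 : 1 <= e.
  by rewrite invf_ge1 // -[leRHS]sqrtr1 ler_sqrt // ltW.
have U2 : 0 < U_H + 2 by have := U0; lra.
have h1 : Num.sqrt k + 1 <= (Num.sqrt (U_H + 2) + 1) * e.
  have : Num.sqrt k <= Num.sqrt (U_H + 2) * e.
    rewrite /e -sqrtrV ?(ltW e0) // -sqrtrM ?(ltW U2) // ler_sqrt //.
    by rewrite divr_ge0 // ltW.
  by rewrite mulrDl mul1r; lra.
have lnE : `|ln eH| = - ln eH by rewrite ler0_norm // ln_le0 // ltW.
have D1 : 1 <= 24 * (U_H + 2) ^+ 4 / zeta.
  rewrite ler_pdivlMr // mul1r.
  have : 1 <= (U_H + 2) ^+ 4 by apply: exprn_ege1; have := U0; lra.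
  lra.
have D0 := ln_ge0 D1; set D := ln _ in D0.
have h2 : ln (24 * k ^+ 4 / zeta) <= D + 4 * `|ln eH|.
  have p4 : 0 < 24 * (U_H + 2) ^+ 4 / zeta by lra.
  have -> : D + 4 * `|ln eH| = ln (24 * (U_H + 2) ^+ 4 / zeta * eH ^- 4).
    rewrite lnM ?posrE ?invr_gt0 ?exprn_gt0 // lnV ?posrE ?exprn_gt0 // lnXn //.
    by rewrite lnE -/D; ring.
  have k4 : k ^+ 4 <= (U_H + 2) ^+ 4 * eH ^- 4.
    rewrite -exprVn -exprMn; apply: lerXn2r; rewrite ?nnegrE //; first by lra.
    by rewrite divr_ge0 // ltW.
  rewrite ler_ln ?posrE; last 2 first.
  - by rewrite divr_gt0 // mulr_gt0 // exprn_gt0; lra.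
  - by rewrite mulr_gt0 // invr_gt0 exprn_gt0.
  by rewrite [leRHS]mulrAC ler_pM2r ?invr_gt0 // -mulrA ler_pM2l.
have l0 := normr_ge0 (ln eH).
have h3 : D + 4 * `|ln eH| <= (D + 4) * (1 + `|ln eH|).
  by have := mulr_ge0 D0 l0; lra.
rewrite /cg_J_real -/k.
have -> : 2 * (Num.sqrt (U_H + 2) + 1) * (D + 4) * e * (1 + `|ln eH|) =
  2 * ((Num.sqrt (U_H + 2) + 1) * e) * ((D + 4) * (1 + `|ln eH|)) by ring.
apply: ler_pM; last exact: le_trans h2 h3.
- by rewrite mulr_ge0 // addr_ge0 ?sqrtr_ge0.
- apply: ln_ge0; rewrite ler_pdivlMr // mul1r.
  have : 1 <= k ^+ 4 by apply: exprn_ege1; lra.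
  lra.
- by rewrite ler_pM2l.
Qed.

Lemma cg_J_le eH : 0 < eH < 1 -> (cg_J U_H eH zeta)%:~R <=
  (2 * (Num.sqrt (U_H + 2) + 1) * (ln (24 * (U_H + 2) ^+ 4 / zeta) + 4) + 1) *
  (Num.sqrt eH)^-1 * (1 + `|ln eH|).
Proof.
move=> eH01; have /andP[e0 e1] := eH01.
have [k [-> _ _ /le_trans h]] := cg_J_spec e0 zeta01 U0.
apply: h; rewrite 2!mulrDl mul1r lerD //; first exact: cg_J_real_le.
have : 1 <= (Num.sqrt eH)^-1.
  by rewrite invf_ge1 ?sqrtr_gt0 // -[leRHS]sqrtr1 ler_sqrt // ltW.
move=> h1; rewrite -[leLHS]mulr1; apply: ler_pM => //.
by rewrite lerDl.
Qed.

(** The factor [cg_J] contributes [(sqrt eH)^-1] and one logarithm. *)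
Lemma softO_large : soft_O (fun m eg eH => [/\ (0 < m)%N, 0 < eg, 0 < eH < 1 &
      cg_J U_H eH zeta <= m%:Z])
  (dncg_bound theta zeta eta L_H U_H Delta)
  (fun _ eg eH => Num.max (eg ^- 3 * eH `^ (5 / 2)) (eH `^ (- (7 / 2)))).
Proof.
set C2 := 2 * (Num.sqrt (U_H + 2) + 1) * (ln (24 * (U_H + 2) ^+ 4 / zeta) + 4) + 1.
have C20 : 0 < C2.
  case/andP: zeta01 => z0 z1; have u0 := U0.
  have u1 : 0 <= 2 * (Num.sqrt (U_H + 2) + 1).
    by rewrite mulr_ge0 // addr_ge0 ?sqrtr_ge0.
  have u4 : 1 <= (U_H + 2) ^+ 4 by apply: exprn_ege1; lra.
  have ln0 : 0 <= ln (24 * (U_H + 2) ^+ 4 / zeta).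
    by apply: ln_ge0; rewrite ler_pdivlMr // mul1r; lra.
  by apply: ltr_wpDl => //; apply: mulr_ge0 => //; rewrite addr_ge0.
have C10 : 0 < Delta / c + 2.
  by rewrite ltr_wpDl // divr_ge0 // ltW // step_constant_gt0.
exists (4 * C2 * (Delta / c + 2)), 1%N; split; first by rewrite !mulr_gt0.
move=> m eg eH [m0 eg0 eH01 Jm]; have /andP[e0 e1] := eH01.
have [k [JE k0 _ _]] := cg_J_spec e0 zeta01 U0.
have Jle := cg_J_le eH01; rewrite -/C2 in Jle.
have K0 := K1bar_ge0 eg eH01; rewrite -(ler_int R) in K0.
have Kle := K1bar_le eg eH01.
rewrite /dncg_bound (min_idPr Jm).
set e := (Num.sqrt eH)^-1 in Jle.
have e_gt0 : 0 < e by rewrite invr_gt0 sqrtr_gt0.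
have qE : Num.max (eg ^- 3 * eH `^ (5 / 2)) (eH `^ (- (7 / 2))) = e * decay eg eH.
  have h12 : eH `^ (- 2^-1) = e by rewrite powRN powR12_sqrt // ltW.
  have nz : eH != 0 by rewrite gt_eqF.
  have -> : eH `^ (5 / 2) = eH ^+ 3 * e.
    have -> : 5 / 2 = 3%:R + - 2^-1 :> R by field.
    by rewrite powRD ?nz ?implybT // h12 powR_mulrn // ltW.
  have -> : eH `^ (- (7 / 2)) = eH ^- 3 * e.
    have -> : - (7 / 2) = - 3%:R + - 2^-1 :> R by field.
    by rewrite powRD ?nz ?implybT // h12 powRN powR_mulrn // ltW.
  by rewrite /decay maxr_pMr ?(ltW e_gt0) // mulrA !(mulrC e).
rewrite qE ger0_norm; last first.
  by rewrite mulr_ge0 // ?addr_ge0 // mulr_ge0 // JE ler0n.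
have d1 := decay_ge1 eg eH01.
have q0 : 0 <= e * decay eg eH by rewrite mulr_ge0 ?(ltW e_gt0) //; lra.
rewrite (ger0_norm q0) expr1.
have J1 : (1 : R) <= (cg_J U_H eH zeta)%:~R by rewrite JE ler1n.
have l1 := normr_ge0 (ln eg); have l2 := normr_ge0 (ln eH).
have lhs0 : 0 <= 2 * (cg_J U_H eH zeta)%:~R + 2 :> R by lra.
apply: (@le_trans _ _ ((4 * (C2 * e * (1 + `|ln eH|))) * ((Delta / c + 2) * decay eg eH))).
  by apply: ler_pM => //; [rewrite addr_ge0|lra].
have -> : 4 * (C2 * e * (1 + `|ln eH|)) * ((Delta / c + 2) * decay eg eH) =
  4 * C2 * (Delta / c + 2) * (1 + `|ln eH|) * (e * decay eg eH) by ring.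
apply: ler_wpM2r => //; apply: ler_wpM2l; last by lra.
by rewrite ltW // !mulr_gt0.
Qed.

Lemma softO_small : soft_O (fun m eg eH => [/\ (0 < m)%N, 0 < eg, 0 < eH < 1 &
      m%:Z <= cg_J U_H eH zeta])
  (dncg_bound theta zeta eta L_H U_H Delta)
  (fun m eg eH => m%:R * Num.max (eg ^- 3 * eH ^+ 3) (eH ^- 3)).
Proof.
have C10 : 0 < Delta / c + 2.
  by rewrite ltr_wpDl // divr_ge0 // ltW // step_constant_gt0.
exists (4 * (Delta / c + 2)), 0%N; split; first by rewrite !mulr_gt0.
move=> m eg eH [m0 eg0 eH01 mJ].
have K0 := K1bar_ge0 eg eH01; rewrite -(ler_int R) in K0.
have Kle := K1bar_le eg eH01.
rewrite /dncg_bound (min_idPl mJ) -/(decay eg eH).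
have m1 : (1 : R) <= m%:R by rewrite ler1n.
have d1 := decay_ge1 eg eH01.
rewrite ger0_norm; last by rewrite mulr_ge0 // addr_ge0 // mulr_ge0 // ler0n.
have q0 : 0 <= m%:R * decay eg eH by apply: mulr_ge0; lra.
rewrite (ger0_norm q0) expr0 mulr1.
have -> : 4 * (Delta / c + 2) * (m%:R * decay eg eH) =
  4 * m%:R * ((Delta / c + 2) * decay eg eH) by ring.
apply: ler_pM; last exact: Kle.
- by rewrite addr_ge0 // mulr_ge0 // ler0n.
- by rewrite addr_ge0.
- by rewrite -pmulrn; lra.
Qed.

End Complexity.

(** * Counting along a run *)

Lemma product_countS (s h k : nat) (mu : int) :
  s%:Z <= k%:Z * (2 * mu + 1) -> h%:Z <= 2 * mu + 1 ->
  (s + h)%N%:Z <= k.+1%:Z * (2 * mu + 1).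
Proof. lia. Qed.

Lemma cost_of_product_count (s k : nat) (mu : int) :
  s%:Z <= k%:Z * (2 * mu + 1) -> (s + k.+1)%N%:Z <= k%:Z * (2 * mu + 2) + 1.
Proof. lia. Qed.

Lemma cost_le_bound (s k : nat) (mu K : int) : 0 <= mu ->
  s%:Z <= k%:Z * (2 * mu + 2) + 1 -> k%:Z <= K ->
  s%:Z <= (2 * mu + 2) * (K + 1).
Proof. nia. Qed.

Section Iteration.
Context {R : realType} {n : nat}.
Variables (f : 'cV[R]_n -> R) (N : set 'cV[R]_n) (x0 : 'cV[R]_n).
Variables (L_H U_H eps_g eps_H theta zeta eta : R) (Mopt : option R).
Hypotheses (hf : twice_lipschitz_differentiable N f L_H) (oN : open N).
Hypotheses (cl : closed (level_set f x0)) (sub : level_set f x0 `<=` N).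
Hypotheses (L0 : 0 <= L_H) (eps_g0 : 0 < eps_g) (eps_H0 : 0 < eps_H).
Hypotheses (theta01 : 0 < theta < 1) (zeta01 : 0 < zeta < 1) (eta0 : 0 < eta).
Hypotheses (M0 : 0 <= odflt 0 Mopt) (UH0 : 0 <= U_H).

Let c := Num.min (c_sol theta zeta eta L_H) (c_nc theta eta L_H).
Let m := Num.min (eps_g / eps_H) eps_H.
Let mu := Num.min n%:Z (cg_J U_H eps_H zeta).

Section At.
Variable x : 'cV[R]_n.
Hypotheses (lx : level_set f x0 x) (gx : eps_g < enorm (grad f x)).
Hypothesis MU : forall d ty hv M,
  capped_cg_call f eps_H zeta Mopt x d ty hv M -> M <= U_H.

Let grad_neq0 : grad f x != 0.
Proof. by rewrite -enorm_gt0; exact: lt_trans gx. Qed.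

Let symH : (hess f x)^T = hess f x.
Proof. exact: hess_sym hf L0 oN (sub lx). Qed.

Lemma dncg_direction_exists :
  exists o hv, dncg_direction f eps_g eps_H zeta Mopt x o hv.
Proof.
have [d [ty [hv [M call]]]] := capped_cg_returns symH eps_H0 M0 grad_neq0 zeta01.
case: ty call => call.
  by exists (Some (nc_direction f x d)), hv; exact: Dir_NC call.
by exists (Some d), hv; exact: Dir_SOL call.
Qed.

(** The guaranteed decrease supposes a large gradient at the new iterate: a unit
    Newton step may be arbitrarily short if it lands near a stationary point. *)
Lemma direction_progress o hv : dncg_direction f eps_g eps_H zeta Mopt x o hv ->
  exists d, [/\ o = Some d, hv%:Z <= 2 * mu + 1,
    exists j, ls_accept f theta eta x d j &
    forall j, ls_tries f theta eta x d j -> ls_accept f theta eta x d j ->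
      eps_g < enorm (grad f (x + theta ^+ j *: d)) ->
      f (x + theta ^+ j *: d) < f x - c * m ^+ 3].
Proof.
have c_le_sol : c <= c_sol theta zeta eta L_H by rewrite ge_min lexx.
have c_le_nc : c <= c_nc theta eta L_H by rewrite ge_min lexx orbT.
have m_le_eps : m <= eps_H by rewrite ge_min lexx orbT.
have cm a b : c <= a -> m <= b -> f x - a * b ^+ 3 <= f x - c * m ^+ 3.
  move=> ca mb; have c0 := step_constant_gt0 (andP theta01).1 zeta01 eta0 L0.
  have m0 : 0 < m by rewrite lt_min eps_H0 divr_gt0.
  rewrite lerD2l lerN2; apply: ler_pM => //.
  - exact: ltW.
  - by rewrite exprn_ge0 // ltW.
  - by apply: lerXn2r; rewrite ?nnegrE ?(le_trans (ltW m0)) // ltW.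
case=> [d k M _ call|d k M _ call|v k le|k le]; last 2 first.
- by rewrite leNgt gx in le.
- by rewrite leNgt gx in le.
- have cost := capped_cg_cost symH eps_H0 zeta01 M0 grad_neq0 call (MU call).
  have [gd qd ed] := nc_directionP eps_H0 (capped_cg_NC call).
  have d0 : nc_direction f x d != 0 by rewrite -enorm_gt0; exact: lt_le_trans ed.
  exists (nc_direction f x d); split=> //.
    exact: (nc_ls_accepts hf oN cl sub L0 theta01 eta0 lx d0 gd qd).
  move=> j tries acc _; apply: lt_le_trans (cm _ _ c_le_nc m_le_eps).
  exact: (nc_decrease hf oN cl sub L0 eps_H0 theta01 eta0 lx d0 gd qd).
- have cost := capped_cg_cost symH eps_H0 zeta01 M0 grad_neq0 call (MU call).
  have [d0 gd qd res] := capped_cg_SOL symH eps_H0 zeta01 M0 grad_neq0 call.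
  exists d; split=> //.
    exact: (sol_ls_accepts hf oN cl sub L0 eps_H0 theta01 eta0 lx d0 gd qd).
  move=> j tries acc gj; apply: lt_le_trans (cm _ _ c_le_sol (lexx m)).
  exact: (sol_decrease hf oN cl sub L0 eps_H0 theta01 zeta01 eta0 lx d0 gd qd res).
Qed.

Lemma iteration_progress o hv nx :
  dncg_iteration f eps_g eps_H theta zeta eta Mopt x o hv nx ->
  exists x', [/\ nx = Some x', f x' < f x, hv%:Z <= 2 * mu + 1 &
    eps_g < enorm (grad f x') -> f x' < f x - c * m ^+ 3].
Proof.
case=> [d k j dir tries acc|k dir|d k dir nacc|nodir].
- have [d' [[<-] cost _ dec]] := direction_progress dir.
  exists (x + theta ^+ j *: d); split=> //; last exact: dec.
  apply: (lt_le_trans acc); rewrite gerDl oppr_le0.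
  have tj := ltW (theta_exp_gt0 theta01 j).
  apply: mulr_ge0; last by rewrite exprn_ge0 ?enorm_ge0.
  by apply: mulr_ge0; [rewrite divr_ge0 // ltW|rewrite exprn_ge0].
- by have [d' []] := direction_progress dir.
- have [d' [[<-] _ [j acc] _]] := direction_progress dir.
  by move: acc; rewrite (negbTE (nacc j)).
- by have [dir [k]] := dncg_direction_exists => /nodir.
Qed.

End At.

Variables (t : @dncg_trace R n) (f_low : R).
Hypothesis hrun : dncg_run f eps_g eps_H theta zeta eta Mopt x0 t.
Hypothesis hM : forall k x d ty hv M, iterate t k = Some x ->
  eps_g < enorm (grad f x) ->
  capped_cg_call f eps_H zeta Mopt x d ty hv M -> M <= U_H.
Hypothesis low : forall x, level_set f x0 x -> f_low <= f x.

Let K := K1bar theta zeta eta L_H (f x0 - f_low) eps_g eps_H.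

(** As long as the gradients are large, the decreases add up.  The step to the
    first iterate with a small gradient may decrease [f] arbitrarily little, but
    strictly, so that the [i.-1] steps before it decrease [f] by less than
    [f x0 - f_low]; hence [i <= K]. *)
Lemma run_progress k :
  (exists i x, [/\ iterate t i = Some x, enorm (grad f x) <= eps_g &
     (dncg_cost t i)%:Z <= i%:Z * (2 * mu + 2) + 1 /\ i%:Z <= K]) \/
  (exists x, [/\ iterate t k = Some x, eps_g < enorm (grad f x),
     (\sum_(i < k) hv_count t i)%N%:Z <= k%:Z * (2 * mu + 1) &
     f x <= f x0 - k%:R * (c * m ^+ 3)]).
Proof.
have lx0 : level_set f x0 x0 by exact: lexx.
have D0 : 0 <= f x0 - f_low by rewrite subr_ge0 low.
have c0 : 0 < c := step_constant_gt0 (andP theta01).1 zeta01 eta0 L0.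
have m0 : 0 < m by rewrite lt_min eps_H0 divr_gt0.
have cm0 : 0 < c * m ^+ 3 by rewrite mulr_gt0 // exprn_gt0.
elim: k => [|k [|[x [xk gx cost dec]]]]; last 2 first.
- by left.
- have lx : level_set f x0 x.
    by rewrite /level_set /= (le_trans dec) // gerDl oppr_le0 mulr_ge0 // ltW.
  have := hrun.2 k; rewrite xk => it.
  have MU d ty hv M := @hM k x d ty hv M xk gx.
  have [x' [xk1 dec1 hv1 dec3]] := iteration_progress lx gx MU it.
  have lx' : level_set f x0 x' by apply: le_trans (ltW dec1) _; exact: lx.
  have cost1 : (\sum_(i < k.+1) hv_count t i)%N%:Z <= k.+1%:Z * (2 * mu + 1).
    by rewrite big_ord_recr; exact: product_countS.
  have [small|big] := leP (enorm (grad f x')) eps_g; [left|right].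
    exists k.+1, x'; split=> //; split; first exact: cost_of_product_count.
    have kK : (k%:R : R) < K%:~R.
      apply: (K1bar_gt (andP theta01).1 zeta01 eta0 L0) => //.
      by rewrite -/c -/m; have := low lx'; lra.
    by rewrite (pmulrn 1) ltr_int in kK.
  exists x'; split=> //.
  have := dec3 big; rewrite -natr1 mulrDl mul1r; lra.
have [small|big] := leP (enorm (grad f x0)) eps_g; [left|right].
  exists 0%N, x0; split=> //; first exact: hrun.1.
  split; first by apply: cost_of_product_count; rewrite big_ord0 mul0r.
  rewrite -(ler_int R); apply: (K1bar_ge (andP theta01).1 zeta01 eta0 L0) => //.
  by rewrite mul0r.
exists x0; split=> //; first exact: hrun.1.
  by rewrite big_ord0 mul0r.
by rewrite mul0r subr0.
Qed.

Lemma run_reaches_small_gradient : exists k x,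
  [/\ iterate t k = Some x, enorm (grad f x) <= eps_g &
      (dncg_cost t k)%:R <=
        dncg_bound theta zeta eta L_H U_H (f x0 - f_low) n eps_g eps_H].
Proof.
have c0 : 0 < c := step_constant_gt0 (andP theta01).1 zeta01 eta0 L0.
have m0 : 0 < m by rewrite lt_min eps_H0 divr_gt0.
case: (run_progress (`|K|.+1)) => [[i [x [xi gx [cost iK]]]]|[x [xk gx _ dec]]].
  exists i, x; split=> //.
  have mu0 : 0 <= mu.
    have [k [JE _ _ _]] := cg_J_spec eps_H0 zeta01 UH0.
    by rewrite /mu JE le_min !lez_nat.
  have := cost_le_bound mu0 cost iK.
  by rewrite -(ler_int R) intrM !intrD intrM.
exfalso; have lx : level_set f x0 x.
  rewrite /level_set /= (le_trans dec) // gerDl oppr_le0 mulr_ge0 //.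
  by rewrite mulr_ge0 ?exprn_ge0 // ltW.
have D0 : 0 <= f x0 - f_low by rewrite subr_ge0; apply: low; exact: lexx.
have : ((`|K|.+1)%:R : R) <= K%:~R.
  apply: (K1bar_ge (andP theta01).1 zeta01 eta0 L0) => //.
  by rewrite -/c -/m lerBrDr addrC -lerBrDr (le_trans (low lx)).
by rewrite (pmulrn 1) ler_int leNgt (le_lt_trans (lez_abs K)) // ltz_nat.
Qed.

End Iteration.

Theorem corollary1 (R : realType) (n : nat) (f : 'cV[R]_n -> R) (x0 : 'cV[R]_n)
    (eps_g eps_H theta zeta eta : R) (Mopt : option R) (t : dncg_trace)
    (N : set 'cV[R]_n) (L_H f_low U_H : R)
    (heps_g : 0 < eps_g) (heps_H : 0 < eps_H < 1) (htheta : 0 < theta < 1)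
    (hzeta : 0 < zeta < 1) (heta : 0 < eta)
    (hrun : dncg_run f eps_g eps_H theta zeta eta Mopt x0 t)
    (hMopt : forall M, Mopt = Some M ->
       0 < M /\ forall k x, iterate t k = Some x -> opnorm (hess f x) <= M)
    (hcompact : compact (level_set f x0))
    (hNopen : open N) (hNlevel : level_set f x0 `<=` N)
    (hNtrial : trial_point f theta eta t `<=` N)
    (hL_H : 0 <= L_H) (hf : twice_lipschitz_differentiable N f L_H)
    (hf_low : forall x, level_set f x0 x -> f_low <= f x)
    (hU_H0 : 0 < U_H)
    (hU_H : forall x, level_set f x0 x -> opnorm (hess f x) <= U_H)
    (hM : forall k x d ty hv M, iterate t k = Some x ->
       eps_g < enorm (grad f x) ->
       capped_cg_call f eps_H zeta Mopt x d ty hv M -> M <= U_H) :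
  let bound := dncg_bound theta zeta eta L_H U_H (f x0 - f_low) in
  [/\ exists k x, [/\ iterate t k = Some x, enorm (grad f x) <= eps_g &
        (dncg_cost t k)%:R <= bound n eps_g eps_H],
      soft_O (fun m eg eH => [/\ (0 < m)%N, 0 < eg, 0 < eH < 1 &
                                 cg_J U_H eH zeta <= m%:Z])
        bound
        (fun m eg eH => Num.max (eg ^- 3 * eH `^ (5 / 2)) (eH `^ (- (7 / 2)))) &
      soft_O (fun m eg eH => [/\ (0 < m)%N, 0 < eg, 0 < eH < 1 &
                                 m%:Z <= cg_J U_H eH zeta])
        bound
        (fun m eg eH => m%:R * Num.max (eg ^- 3 * eH ^+ 3) (eH ^- 3))].
Proof.
have cl : closed (level_set f x0).
  by apply: compact_closed hcompact; exact: norm_hausdorff.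
have /andP[eps_H0 _] := heps_H.
have M0 : 0 <= odflt 0 Mopt.
  by case: Mopt hMopt {hrun hM} => [M|] //= /(_ M erefl)[/ltW].
have Delta0 : 0 <= f x0 - f_low by rewrite subr_ge0; apply: hf_low; exact: lexx.
have /andP[theta0 _] := htheta; have U0 := ltW hU_H0.
split.
- exact: (run_reaches_small_gradient hf hNopen cl hNlevel hL_H heps_g eps_H0
    htheta hzeta heta M0 U0 hrun hM hf_low).
- exact: softO_large.
- exact: softO_small.
Qed.
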